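(* Let $G$ be a Lie group acting on a smooth manifold $M$. Then $$HC^\bullet(\mathcal{H}(G,M))=\bigoplus_{k\ge 0}H^{\bullet-2k}(G;(\Omega^*(M),d)),$$ where $HC^\bullet(\mathcal{H}(G,M))$ is the cyclic cohomology of the Hopf algebroid $\mathcal{H}(G,M)$ and $H^{\bullet}(G;(\Omega^*(M),d))$ is the differentiable cohomology of $G$ with coefficients in the de Rham complex of $M$.
   Context: Action conventions. $G$ acts smoothly on $M$. For $g\in G$, $g^*$ denotes the induced algebra automorphism of $\Omega^*(M)$, with the convention that $(g_1g_2)^*=g_1^*g_2^*$ (that is, pull-back by $g$ for an action written on the right; for a left action, pull-back along $x\mapsto g^{-1}x$). The Hopf algebroid $\mathcal{H}(G,M)$. Let $B=\Omega^*(M)$ be the algebra of differential forms on $M$ and $A=C^\infty(G,\Omega^*(M))$ the algebra of $B$-valued smooth functions on $G$; both are differential graded algebras with the de Rham differential $d$ (acting pointwise in $G$ on $A$). Source and target maps $\alpha,\beta:B\to A$: $\alpha(b)(g)=b$, $\beta(b)(g)=g^*(b)$. With the projective tensor product, $A\otimes_BA$ is identified with $B$-valued functions on $G\times G$ by $(\phi\otimes_B\psi)(g_1,g_2)=\phi(g_1)\,g_1^*(\psi(g_2))$, and similarly the $n$-fold product $A\otimes_B\cdots\otimes_BA$ is identified with $C^\infty(G^{\times n},\Omega^*(M))$. Coproduct: $\Delta(\phi)(g_1,g_2)=\phi(g_1g_2)$. Counit: $\epsilon(\phi)=\phi(1)$. Antipode: $S(\phi)(g)=g^*(\phi(g^{-1}))$.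 These data form the (para) Hopf algebroid $\mathcal{H}(G,M)$. Cyclic cohomology. The associated cocyclic module has $C^0=B$, $C^n=A\otimes_B\cdots\otimes_BA$ ($n$ factors), with cofaces $\delta_0(a^1\otimes\cdots\otimes a^{n-1})=1\otimes a^1\otimes\cdots\otimes a^{n-1}$, $\delta_i=$ apply $\Delta$ to $a^i$ ($1\le i\le n-1$), $\delta_n(a^1\otimes\cdots\otimes a^{n-1})=a^1\otimes\cdots\otimes a^{n-1}\otimes 1$ (on $C^0$: $\delta_0=\beta$, $\delta_1=\alpha$), codegeneracies $\sigma_i=$ apply $\epsilon$ to $a^{i+1}$, and cyclic operator $\tau_n(a^1\otimes\cdots\otimes a^n)=(\Delta^{n-1}S(a^1))(a^2\otimes\cdots\otimes a^n\otimes 1)$ ($\tau_0=\mathrm{id}$). The de Rham differential is part of the structure: a cochain in $C^\infty(G^{\times p},\Omega^q(M))$ has total degree $p+q$, the Hochschild complex is the total complex with differential combining $b=\sum(-1)^i\delta_i$ and $d$ (with the usual sign), and $HC^\bullet(\mathcal{H}(G,M))$ is the cyclic cohomology of this differential graded cocyclic module, i.e. the cohomology of the total complex, in degree $n$ the sum over $k\ge0$ of the total degree $n-2k$ cochains, with differential combining $b$, $d$ and the Connes operator $B=\big(\sum_{i=0}^{n}(-1)^{ni}\tau_n^i\big)\sigma_n\tau_{n+1}\big(1-(-1)^{n+1}\tau_{n+1}\big):C^{n+1}\to C^n$. Differentiable cohomology. For a $G$-equivariant bundle $E$ on $M$ put $C^p_d(G;E)=C^\infty(G^{\times p};\Gamma(E))$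 with differential $$(\partial c)(g_1,\dots,g_{p+1})=g_1^*(c(g_2,\dots,g_{p+1}))+\sum_{i=1}^p(-1)^ic(g_1,\dots,g_ig_{i+1},\dots,g_{p+1})+(-1)^{p+1}c(g_1,\dots,g_p).$$ $H^\bullet(G;(\Omega^*(M),d))$ is the cohomology of the total complex of the double complex $C^\infty(G^{\times p},\Omega^q(M))$ with differentials $\partial$ and the de Rham differential $d$ (with the usual sign), total degree $p+q$; it is zero in negative degrees. *)

(* Defs.v *)
From HB Require Import structures.
From mathcomp Require Import all_boot all_order all_algebra.
From mathcomp Require Import generic_quotient ring_quotient.
From mathcomp Require Import all_classical all_reals all_analysis.
Set Implicit Arguments.
Unset Strict Implicit.
Unset Printing Implicit Defensive.
Import Order.TTheory GRing.Theory Num.Theory.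
Import numFieldNormedType.Exports.
Local Open Scope classical_set_scope.
Local Open Scope ring_scope.

(* Product of a family of modules. *)
Definition dfam (R : pzRingType) (I : Type) (V : I -> lmodType R) : Type :=
  forall i, V i.

Section Dfam.
Variables (R : pzRingType) (I : Type) (V : I -> lmodType R).
Implicit Types x y z : dfam V.

HB.instance Definition _ := gen_eqMixin (dfam V).
HB.instance Definition _ := gen_choiceMixin (dfam V).

Let add x y : dfam V := fun i => x i + y i.
Let opp x : dfam V := fun i => - x i.
Let scale a x : dfam V := fun i => a *: x i.

Fact dfam_addA : associative add.
Proof. by move=> x y z; apply/functional_extensionality_dep => i; apply: addrA. Qed.
Fact dfam_addC : commutative add.
Proof. by move=> x y; apply/functional_extensionality_dep => i; apply: addrC. Qed.
Fact dfam_add0 : left_id (fun i => 0 : V i) add.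
Proof. by move=> x; apply/functional_extensionality_dep => i; apply: add0r. Qed.
Fact dfam_addN : left_inverse (fun i => 0 : V i) opp add.
Proof. by move=> x; apply/functional_extensionality_dep => i; apply: addNr. Qed.
HB.instance Definition _ :=
  GRing.isZmodule.Build (dfam V) dfam_addA dfam_addC dfam_add0 dfam_addN.

Fact dfam_scaleA a b x : scale a (scale b x) = scale (a * b) x.
Proof. by apply/functional_extensionality_dep => i; apply: scalerA. Qed.
Fact dfam_scale1 : left_id 1 scale.
Proof. by move=> x; apply/functional_extensionality_dep => i; apply: scale1r. Qed.
Fact dfam_scaleDr : right_distributive scale +%R.
Proof. by move=> a x y; apply/functional_extensionality_dep => i; apply: scalerDr. Qed.
Fact dfam_scaleDl x : {morph scale^~ x : a b / a + b}.
Proof. by move=> a b; apply/functional_extensionality_dep => i; apply: scalerDl. Qed.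
HB.instance Definition _ := GRing.Zmodule_isLmodule.Build R (dfam V)
  dfam_scaleA dfam_scale1 dfam_scaleDr dfam_scaleDl.
End Dfam.

Section SubModule.
Variables (R : pzRingType) (V : lmodType R) (S : submodClosed V).
Record submodule := SubModule { submodule_val : V; _ : submodule_val \in S }.
HB.instance Definition _ := [isSub for submodule_val].
HB.instance Definition _ := [Choice of submodule by <:].
HB.instance Definition _ := [SubChoice_isSubLmodule of submodule by <:].
End SubModule.

Section QuotLmod.
Variables (R : pzRingType) (V : lmodType R) (S : submodClosed V).
Definition zmod_of_submod : {pred V} := S.
Fact zmod_of_submod_closed : zmod_closed zmod_of_submod.
Proof.
split=> [|x y xS yS]; first exact: (rpred0 S).
by rewrite -scaleN1r; apply: (rpredD (S := S)) => //; apply: rpredZ.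
Qed.
HB.instance Definition _ :=
  GRing.isZmodClosed.Build V zmod_of_submod zmod_of_submod_closed.
Definition quotient_module : Type := Quotient.quot zmod_of_submod.
HB.instance Definition _ := GRing.Zmodule.on quotient_module.

Definition quot_class (v : V) : quotient_module := \pi_(Quotient.quot zmod_of_submod)%qT v.
Definition quot_scale (a : R) (x : quotient_module) : quotient_module :=
  quot_class (a *: repr (x : Quotient.quot zmod_of_submod)).

Lemma quot_classP u v : (quot_class u = quot_class v) <-> (u - v \in S).
Proof.
by split=> [/eqP|uv]; [|apply/eqP]; rewrite /quot_class -Quotient.idealrBE.
Qed.
Fact quot_scaleE a v : quot_scale a (quot_class v) = quot_class (a *: v).
Proof.
apply/quot_classP; rewrite -scalerBr rpredZ //; apply/quot_classP.
by rewrite /quot_class reprK.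
Qed.
Fact quot_classE x : x = quot_class (repr (x : Quotient.quot zmod_of_submod)).
Proof. by rewrite /quot_class reprK. Qed.
Fact quot_classD u v : quot_class (u + v) = quot_class u + quot_class v.
Proof. by rewrite /quot_class raddfD. Qed.

Fact quot_scaleA a b x : quot_scale a (quot_scale b x) = quot_scale (a * b) x.
Proof. by rewrite (quot_classE x) !quot_scaleE scalerA. Qed.
Fact quot_scale1 : left_id 1 quot_scale.
Proof. by move=> x; rewrite (quot_classE x) quot_scaleE scale1r. Qed.
Fact quot_scaleDr : right_distributive quot_scale +%R.
Proof.
move=> a x y; rewrite (quot_classE x) (quot_classE y) -quot_classD !quot_scaleE.
by rewrite scalerDr quot_classD.
Qed.
Fact quot_scaleDl x : {morph quot_scale^~ x : a b / a + b}.
Proof. by move=> a b; rewrite (quot_classE x) !quot_scaleE scalerDl quot_classD. Qed.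
HB.instance Definition _ := GRing.Zmodule_isLmodule.Build R quotient_module
  quot_scaleA quot_scale1 quot_scaleDr quot_scaleDl.
End QuotLmod.

Section DirectSum.
Variables (R : pzRingType) (I : Type) (V : I -> lmodType R).
Definition finsupp_pred : {pred dfam V} :=
  fun x => `[< finite_set [set i | x i <> 0] >].
Fact finsupp_closed : submod_closed finsupp_pred.
Proof.
split=> [|a x y].
  by apply/asboolP; rewrite (_ : [set _ | _] = set0) // -subset0 => i; apply.
move=> /asboolP fx /asboolP fy; apply/asboolP.
apply: (@sub_finite_set _ _ ([set i | x i <> 0] `|` [set i | y i <> 0])).
  move=> i /= axy; have [xi|] := pselect (x i = 0); last by left.
  right=> yi; apply: axy; rewrite -[LHS]/(a *: x i + y i) xi yi.
  by rewrite scaler0 addr0.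
by rewrite finite_setU.
Qed.
HB.instance Definition _ := GRing.isSubmodClosed.Build R _ finsupp_pred finsupp_closed.
Definition direct_sum : Type := submodule finsupp_pred.
HB.instance Definition _ := GRing.Lmodule.on direct_sum.
End DirectSum.

(* complex_diff need only make sense on cochains, hence linearity there. That it
   squares to zero and raises the degree by one is not a field: a cohomology
   class is a cocycle modulo those cocycles that are coboundaries. *)
Record complex (R : pzRingType) := Complex {
  complex_space :> lmodType R;
  complex_cochains : int -> set complex_space;
  complex_diff : complex_space -> complex_space;
  complex_cochains_zero : forall d, complex_cochains d 0;
  complex_cochains_linear : forall d a x y, complex_cochains d x ->
    complex_cochains d y -> complex_cochains d (a *: x + y);
  complex_diff_linear : forall d a x y, complex_cochains d x ->
    complex_cochains d y ->
    complex_diff (a *: x + y) = a *: complex_diff x + complex_diff y }.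

Section Cohomology.
Variables (R : pzRingType) (K : complex R) (d : int).

Definition cocycle : {pred K} := fun x =>
  `[< complex_cochains d x /\ complex_diff x = 0 >].

Fact complex_diff0 : complex_diff (0 : K) = 0.
Proof.
have c0 := @complex_cochains_zero R K 0.
have := @complex_diff_linear R K 0 (-1) 0 0 c0 c0.
by rewrite scaler0 add0r scaleN1r addNr.
Qed.

Fact cocycle_closed : submod_closed cocycle.
Proof.
split=> [|a x y].
  by apply/asboolP; split; [exact: complex_cochains_zero|exact: complex_diff0].
move=> /asboolP[xd x0] /asboolP[yd y0]; apply/asboolP; split.
  exact: complex_cochains_linear.
by rewrite (complex_diff_linear a xd yd) x0 y0 scaler0 addr0.
Qed.
HB.instance Definition _ :=
  GRing.isSubmodClosed.Build R _ cocycle cocycle_closed.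

Definition coboundary : {pred submodule cocycle} := fun z =>
  `[< exists2 w, complex_cochains (d - 1) w & complex_diff w = submodule_val z >].

Fact coboundary_closed : submod_closed coboundary.
Proof.
split=> [|a x y].
  apply/asboolP; exists 0; first exact: complex_cochains_zero.
  by rewrite complex_diff0.
move=> /asboolP[u ud ux] /asboolP[w wd wy]; apply/asboolP.
exists (a *: u + w); first exact: complex_cochains_linear.
by rewrite (complex_diff_linear a ud wd) ux wy.
Qed.
HB.instance Definition _ :=
  GRing.isSubmodClosed.Build R _ coboundary coboundary_closed.

Definition cohomology : Type := quotient_module coboundary.
HB.instance Definition _ := GRing.Lmodule.on cohomology.
End Cohomology.

(* All iterated directional derivatives exist and are differentiable on the
   open set U; V is finite dimensional in every use. *)
Definition Cinfty (R : realType) (V W : normedModType R) (U : set V)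
    (f : V -> W) : Prop :=
  forall (vs : seq V) (x : V), U x ->
    differentiable (foldr (fun v h => 'D_v h) f vs) x.

(* chart_map and chart_inv are total functions; they are meaningful only on
   chart_dom and chart_cod. *)
Record chart (R : realType) (T : Type) (E : normedModType R) := Chart {
  chart_dom : set T;
  chart_cod : set E;
  chart_map : T -> E;
  chart_inv : E -> T }.

Definition is_chart (R : realType) (T : topologicalType) (E : normedModType R)
    (c : chart T E) : Prop :=
  [/\ open (chart_dom c) /\ open (chart_cod c),
      {homo chart_map c : x / chart_dom c x >-> chart_cod c x} /\
      {homo chart_inv c : u / chart_cod c u >-> chart_dom c u},
      (forall x, chart_dom c x -> chart_inv c (chart_map c x) = x) /\
      (forall u, chart_cod c u -> chart_map c (chart_inv c u) = u) &
      (forall x, chart_dom c x -> {for x, continuous (chart_map c)}) /\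
      (forall u, chart_cod c u -> {for u, continuous (chart_inv c)}) ].

Definition prod_chart (R : realType) (T1 T2 : Type) (E1 E2 : normedModType R)
    (c1 : chart T1 E1) (c2 : chart T2 E2) : chart (T1 * T2) (E1 * E2)%type :=
  {| chart_dom := chart_dom c1 `*` chart_dom c2;
     chart_cod := chart_cod c1 `*` chart_cod c2;
     chart_map := fun x => (chart_map c1 x.1, chart_map c2 x.2);
     chart_inv := fun u => (chart_inv c1 u.1, chart_inv c2 u.2) |}.

Definition prod_atlas (R : realType) (T1 T2 : Type) (E1 E2 : normedModType R)
    (A1 : set (chart T1 E1)) (A2 : set (chart T2 E2)) :
    set (chart (T1 * T2) (E1 * E2)%type) :=
  [set c | exists c1 c2, [/\ A1 c1, A2 c2 & c = prod_chart c1 c2]].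

Definition smooth_map (R : realType) (T1 T2 : topologicalType)
    (E1 E2 : normedModType R) (A1 : set (chart T1 E1)) (A2 : set (chart T2 E2))
    (f : T1 -> T2) : Prop :=
  continuous f /\
  forall c1 c2, A1 c1 -> A2 c2 ->
    Cinfty (chart_cod c1 `&` (f \o chart_inv c1) @^-1` chart_dom c2)
      (chart_map c2 \o f \o chart_inv c1).

HB.mixin Record isManifold (R : realType) (n : nat) T of Topological T := {
  atlas : set (chart T 'rV[R]_n);
  atlas_chart : forall c, atlas c -> is_chart c;
  atlas_cover : forall x : T, exists c, atlas c /\ chart_dom c x;
  atlas_compat : forall c c', atlas c -> atlas c' ->
    Cinfty (chart_cod c `&` chart_inv c @^-1` chart_dom c')
      (chart_map c' \o chart_inv c);
  manifold_hausdorff : hausdorff_space T;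
  manifold_second_countable : @second_countable T }.

#[short(type="manifoldType")]
HB.structure Definition Manifold (R : realType) (n : nat) :=
  {T of isManifold R n T & Topological T}.

HB.mixin Record isLieGroup (R : realType) (n : nat) G
    of Manifold R n G & Group G := {
  smooth_mul : smooth_map (prod_atlas (@atlas R n G) (@atlas R n G))
    (@atlas R n G) (fun x : G * G => (x.1 * x.2)%g);
  smooth_inv : smooth_map (@atlas R n G) (@atlas R n G) (fun x : G => x^-1%g) }.

#[short(type="lieGroupType")]
HB.structure Definition LieGroup (R : realType) (n : nat) :=
  {G of isLieGroup R n G & Manifold R n G & Group G}.

Record smooth_action (R : realType) (n m : nat) (G : lieGroupType R n)
    (M : manifoldType R m) (act : G -> M -> M) : Prop := {
  act_one : forall x, act 1%g x = x;
  act_mul : forall g h x, act (g * h)%g x = act g (act h x);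
  act_smooth : smooth_map (prod_atlas (@atlas R n G) (@atlas R m M))
    (@atlas R m M) (fun z : G * M => act z.1 z.2) }.

Section Forms.
Variables (R : realType) (m : nat) (M : manifoldType R m).

Definition chart_at (x : M) : chart M 'rV[R]_m := projT1 (cid (atlas_cover x)).

Lemma chart_at_atlas (x : M) : @atlas R m M (chart_at x).
Proof. by rewrite /chart_at; case: cid => c []. Qed.
Lemma chart_at_dom (x : M) : chart_dom (chart_at x) x.
Proof. by rewrite /chart_at; case: cid => c []. Qed.

(* The tangent space at x is 'rV[R]_m, by means of the coordinates of the chart
   chart_at x. An element of form_at q is an arbitrary function of x and of q
   tangent vectors at x; multilinearity and smoothness are imposed on cochains
   by smooth_cochain below. *)
Definition form_at (q : nat) : Type := M -> ('I_q -> 'rV[R]_m) -> R^o.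
HB.instance Definition _ q := GRing.Lmodule.on (form_at q).
Definition forms := dfam form_at.
HB.instance Definition _ := GRing.Lmodule.on forms.

Definition pullback (F : M -> M) (w : forms) : forms := fun q x v =>
  w q (F x) (fun i =>
    'D_(v i) (chart_map (chart_at (F x)) \o F \o chart_inv (chart_at x))
      (chart_map (chart_at x) x)).

(* The expression of w in the chart c. *)
Definition local_form (c : chart M 'rV[R]_m) (q : nat) (w : form_at q)
    (u : 'rV[R]_m) (v : 'I_q -> 'rV[R]_m) : R^o :=
  w (chart_inv c u) (fun i =>
    'D_(v i) (chart_map (chart_at (chart_inv c u)) \o chart_inv c) u).

(* The usual formula for the exterior derivative on constant, hence commuting,
   vector fields in the chart at x. *)
Definition ext_deriv_at (q : nat) (w : form_at q) : form_at q.+1 := fun x v =>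
  \sum_(i < q.+1) (-1) ^+ i *:
    'D_(v i) (fun u => local_form (chart_at x) w u (fun j => v (lift i j)))
      (chart_map (chart_at x) x).

Definition ext_deriv (w : forms) : forms := fun q =>
  match q with 0 => 0 | q'.+1 => ext_deriv_at (w q') end.

Definition multilinear_alternating (q : nat) (f : ('I_q -> 'rV[R]_m) -> R) :=
  (forall (i : 'I_q) (v : 'I_q -> 'rV[R]_m) (a : R) (u u' : 'rV[R]_m),
     f (dfwith v i (a *: u + u')) =
     a * f (dfwith v i u) + f (dfwith v i u')) /\
  (forall v i j, i != j -> v i = v j -> f v = 0).

(* wedge is the sum over shuffles: S is the set of arguments given to w. *)
Definition shuffle_inversions (q : nat) (S : {set 'I_q}) : nat :=
  #|[set ij : 'I_q * 'I_q |
      [&& ij.1 \in S, ij.2 \notin S & (ij.2 < ij.1)%N]]%SET|.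

Definition wedge (w w' : forms) : forms := fun q x v =>
  \sum_(S : {set 'I_q}) (-1) ^+ shuffle_inversions S *:
    (w #|S| x (v \o enum_val) * w' #|~: S|%SET x (v \o enum_val) : R^o).

Definition form_one : forms := fun q =>
  match q with 0 => fun _ _ => 1 | _.+1 => 0 end.

Lemma pullback_wedge F w w' :
  pullback F (wedge w w') = wedge (pullback F w) (pullback F w').
Proof. by []. Qed.

Lemma pullback_one F : pullback F form_one = form_one.
Proof. by apply/functional_extensionality_dep => -[|q]. Qed.

Lemma form_castE (w : forms) q q' (e : q' = q) (x : M) (v : 'I_q -> 'rV[R]_m)
    (v' : 'I_q' -> 'rV[R]_m) :
  (forall i, v' i = v (cast_ord e i)) -> w q' x v' = w q x v.
Proof.
case: q / e v => v vv'; congr (w _ _ _); apply/funext => i.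
by rewrite vv' cast_ord_id.
Qed.

Lemma wedge1f w : wedge form_one w = w.
Proof.
apply/functional_extensionality_dep => q; apply/funext => x; apply/funext => v.
rewrite /wedge (bigD1 finset.set0) //= [X in _ + X]big1 ?addr0; last first.
  move=> S S0; rewrite (_ : form_one _ _ = 0) ?mul0r ?scaler0 //.
  by rewrite -(cards_eq0 S) in S0; case: #|S| (v \o _) S0 => //.
rewrite (_ : shuffle_inversions _ = 0%N); last first.
  by apply: eq_card0 => -[i j]; rewrite !inE.
rewrite expr0 scale1r [X in X * _](_ : _ = 1); last first.
  by move: (v \o _); rewrite cards0.
have e : #|~: finset.set0 : {set 'I_q}|%SET = q by rewrite finset.setC0 cardsT card_ord.
rewrite mul1r; apply: (@form_castE w _ _ e) => i /=; congr (v _).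
apply: val_inj => /=; rewrite (enum_val_nth (cast_ord e i)).
rewrite [X in nth _ X](_ : _ = enum 'I_q); last by rewrite finset.setC0 enum_setT -enumT.
by rewrite nth_enum_ord // -[X in (_ < X)%N]e.
Qed.

Lemma wedge11 : wedge form_one form_one = form_one.
Proof. exact: wedge1f. Qed.
End Forms.

Arguments form_one {R m M} q x v : rename.
Arguments wedge {R m M} w w' q x v : rename.
Arguments pullback {R m M} F w q x v : rename.
Arguments ext_deriv {R m M} w q x v : rename.

Lemma near_eq_differentiable (R : realType) (V W : normedModType R)
    (f g : V -> W) (a : V) :
  (\forall x \near a, f x = g x) -> differentiable f a -> differentiable g a.
Proof.
move=> fg df; pose z := g - f.
have z0 : \forall x \near a, z x = 0.
  by near=> x; rewrite /z !fctE -(near fg x) ?subrr //.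
suff dz : differentiable z a by rewrite -(subrK f g); apply: differentiableD.
have z0' : \forall h \near (0 : V), (z \o shift a) h = 0.
  by move: z0; rewrite (near_shift 0) subr0.
have zE : z \o shift a = cst (z a) + (\0 : V -> W) +o_ (0 : V) id.
  rewrite (nbhs_singleton z0); apply: eqaddoE.
  rewrite [X in _ = X + _](_ : _ = 0); last first.
    by apply/funext => x; rewrite !fctE /= addr0.
  rewrite add0r; apply: eqoE; apply/eqoP => e e0; near=> h.
  by rewrite (near z0' h) // normr0 mulr_ge0 // ltW.
have c0 : continuous (\0 : V -> W) by apply: cst_continuous.
by apply/diff_locallyP; rewrite (@diff_unique _ _ _ z \0 a c0 zE).
Unshelve. all: by end_near. Qed.

Section CinftyLinear.
Variables (R : realType) (V W : normedModType R) (U : set V).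
Hypothesis oU : open U.
Implicit Types f g : V -> W.

Lemma Cinfty_iter_linear (a : R) f g (vs : seq V) :
  Cinfty U f -> Cinfty U g -> forall x, U x ->
  foldr (fun v h => 'D_v h) (a *: f + g) vs x =
  a *: foldr (fun v h => 'D_v h) f vs x + foldr (fun v h => 'D_v h) g vs x.
Proof.
move=> cf cg; elim: vs => [//|v vs IH] x Ux /=.
set F := foldr _ f vs; set H := foldr _ g vs.
rewrite (@near_eq_derive _ _ _ _ (a *: F + H)).
  have dF : derivable F x v by apply: diff_derivable; exact: cf.
  have dH : derivable H x v by apply: diff_derivable; exact: cg.
  by rewrite deriveD ?deriveZ //; apply: derivableZ.
have := open_nbhs_nbhs (conj oU Ux); apply: filterS => y Uy.
exact: IH.
Qed.

Lemma Cinfty_linear (a : R) f g :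
  Cinfty U f -> Cinfty U g -> Cinfty U (a *: f + g).
Proof.
move=> cf cg vs x Ux.
set F := foldr (fun v h => 'D_v h) f vs; set H := foldr (fun v h => 'D_v h) g vs.
apply: (@near_eq_differentiable _ _ _ (a *: F + H)).
  have := open_nbhs_nbhs (conj oU Ux); apply: filterS => y Uy.
  by rewrite Cinfty_iter_linear.
by apply: differentiableD; [apply: differentiableZ; apply: cf|apply: cg].
Qed.
Lemma Cinfty_zero : Cinfty U (0 : V -> W).
Proof.
move=> vs x _; rewrite (_ : foldr _ _ _ = 0); last first.
  elim: vs => //= v vs ->; apply/funext => y; exact: derive_cst.
exact: differentiable_cst.
Qed.
End CinftyLinear.

Lemma row_continuous (K : numFieldType) (p n : nat) (i : 'I_p) :
  continuous (fun A : 'M[K]_(p, n) => row i A).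
Proof.
move=> A B [P AP sPB].
exists (fun i' j => if i' == i then P ord0 j else setT) => [i' j|X PX].
  case: eqP => [->|_]; last exact: filterT.
  by have := AP ord0 j; rewrite mxE.
apply: sPB => k j; rewrite ord1 mxE.
by have := PX i j; rewrite eqxx.
Qed.

Section Cochains.
Variables (R : realType) (n m : nat) (G : lieGroupType R n) (M : manifoldType R m).
Variable act : G -> M -> M.

(* The automorphism g^* for a left action, so that (g h)^* = g^* h^* (starM). *)
Definition star (g : G) (w : forms M) : forms M := pullback (act g^-1%g) w.

Definition cochain (p : nat) : Type := ('I_p -> G) -> forms M.
HB.instance Definition _ p := GRing.Lmodule.on (cochain p).

(* C^oo(G^p, Omega^*(M)): a map from G^p to the Frechet space of forms is smooth
   when it is jointly smooth in g and x. For p = 0 this is Omega^*(M). *)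
Definition smooth_cochain (p : nat) (phi : cochain p) : Prop :=
  (forall g q x, multilinear_alternating (phi g q x)) /\
  forall (q : nat) (c : 'I_p -> chart G 'rV[R]_n) (e : chart M 'rV[R]_m)
    (v : 'I_q -> 'rV[R]_m),
    (forall i, @atlas R n G (c i)) -> @atlas R m M e ->
    Cinfty
      [set z : 'M[R]_(p, n) * 'rV[R]_m |
        (forall i, chart_cod (c i) (row i z.1)) /\ chart_cod e z.2]
      (fun z =>
         local_form e (phi (fun i => chart_inv (c i) (row i z.1)) q) z.2 v).

Definition cochain_d (p : nat) (phi : cochain p) : cochain p :=
  fun g => ext_deriv (phi g).

Lemma open_cochain_domain (p : nat) (c : 'I_p -> chart G 'rV[R]_n)
    (e : chart M 'rV[R]_m) :
  (forall i, @atlas R n G (c i)) -> @atlas R m M e ->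
  open [set z : 'M[R]_(p, n) * 'rV[R]_m |
         (forall i, chart_cod (c i) (row i z.1)) /\ chart_cod e z.2].
Proof.
move=> ac ae.
have oc i : open (chart_cod (c i)) by have [[]] := @atlas_chart R n G _ (ac i).
have oe : open (chart_cod e) by have [[]] := @atlas_chart R m M _ ae.
rewrite openE => z [/= Ac ue]; rewrite /interior; apply: filterI.
  apply: (@filter_forall _ _
    (fun i (z : 'M[R]_(p, n) * 'rV[R]_m) => chart_cod (c i) (row i z.1)) (nbhs z) _) => i.
  have : {for z, continuous (fun z : 'M[R]_(p, n) * 'rV[R]_m => row i z.1)}.
    by apply: continuous_comp; [exact: cvg_fst|exact: row_continuous].
  move=> /(_ (chart_cod (c i))) H; apply: H.
  by apply: open_nbhs_nbhs; split.
have : {for z, continuous (fun z : 'M[R]_(p, n) * 'rV[R]_m => z.2)}.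
  exact: cvg_snd.
by move=> /(_ (chart_cod e)); apply; apply: open_nbhs_nbhs; split.
Qed.

Lemma smooth_cochain_zero p : smooth_cochain (0 : cochain p).
Proof.
split=> [g q x|q c e v _ _]; last exact: Cinfty_zero.
have E v : (0 : cochain p) g q x v = 0 :> R by [].
by split=> [i v a u u'|//]; rewrite !E mulr0 addr0.
Qed.

Lemma smooth_cochain_linear p (a : R) (phi psi : cochain p) :
  smooth_cochain phi -> smooth_cochain psi -> smooth_cochain (a *: phi + psi).
Proof.
move=> [phiA phiS] [psiA psiS]; split=> [g q x|q c e v ac ae].
  have [l1 a1] := phiA g q x; have [l2 a2] := psiA g q x.
  have E v : (a *: phi + psi) g q x v = a * phi g q x v + psi g q x v by [].
  split=> [i v b u u'|v i j ij vij]; last first.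
    by rewrite E (a1 _ _ _ ij vij) (a2 _ _ _ ij vij) mulr0 addr0.
  by rewrite !E l1 l2 !mulrDr !mulrA (mulrC a b) addrACA.
apply: Cinfty_linear; [exact: open_cochain_domain|exact: phiS|exact: psiS].
Qed.

Lemma derivable_local_form p (phi : cochain p) g q x (v : 'I_q -> 'rV[R]_m) w :
  smooth_cochain phi ->
  derivable (fun u => local_form (chart_at x) (phi g q) u v)
    (chart_map (chart_at x) x) w.
Proof.
move=> [_ phiS]; apply: diff_derivable.
have chG (y : G) : exists c, @atlas R n G c /\ chart_dom c y by exact: atlas_cover.
pose c i := projT1 (cid (chG (g i))).
have ac i : @atlas R n G (c i) by rewrite /c; case: cid => ? [].
have dc i : chart_dom (c i) (g i) by rewrite /c; case: cid => ? [].
pose Z := \matrix_(i, j) (chart_map (c i) (g i)) ord0 j.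
have ZE i : row i Z = chart_map (c i) (g i) by apply/rowP => j; rewrite !mxE.
have gE : (fun i => chart_inv (c i) (row i Z)) = g.
  apply/funext => i; rewrite ZE.
  by have [_ _ [bK _] _] := @atlas_chart R n G _ (ac i); apply: bK.
pose F z := local_form (chart_at x)
  (phi (fun i => chart_inv (c i) (row i z.1)) q) z.2 v.
have := phiS q c (chart_at x) v ac (chart_at_atlas x) [::] (Z, chart_map (chart_at x) x).
rewrite -/F /= => dF.
have FE : (fun u => local_form (chart_at x) (phi g q) u v) = F \o (fun u => (Z, u)).
  by apply/funext => u; rewrite /F /= gE.
rewrite FE; apply: differentiable_comp; first exact: differentiable_pair.
apply: dF; split=> [i|].
  rewrite ZE; have [_ [h _] _ _] := @atlas_chart R n G _ (ac i); exact: h.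
have [_ [h _] _ _] := @atlas_chart R m M _ (chart_at_atlas x); apply: h.
exact: chart_at_dom.
Qed.

Lemma cochain_d_linear p (a : R) (phi psi : cochain p) :
  smooth_cochain phi -> smooth_cochain psi ->
  cochain_d (a *: phi + psi) = a *: cochain_d phi + cochain_d psi.
Proof.
move=> sphi spsi; apply/funext => g; apply/functional_extensionality_dep => -[|q].
  by rewrite -[LHS]/0 -[RHS]/(a *: 0 + 0) scaler0 addr0.
apply/funext => x; apply/funext => v.
rewrite -[RHS]/(a *: ext_deriv_at (phi g q) x v + ext_deriv_at (psi g q) x v).
rewrite -[LHS]/(ext_deriv_at ((a *: phi + psi) g q) x v) /ext_deriv_at.
rewrite scaler_sumr -big_split; apply: eq_bigr => i _ /=.
set vi := fun j => v (lift i j).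
have d1 := @derivable_local_form p phi g q x vi (v i) sphi.
have d2 := @derivable_local_form p psi g q x vi (v i) spsi.
rewrite scalerA [a * _]mulrC -scalerA -scalerDr; congr (_ *: _).
by rewrite -(@deriveZ _ _ _ _ a _ _ d1) -(deriveD (@derivableZ _ _ _ _ a _ _ d1) d2).
Qed.


(* The structure maps of H(G, M): B is the space of forms and A the space of
   functions G -> B. The tensor product of A with itself over B is read as the
   space of functions G x G -> B, with
   (phi * psi)(g1, g2) = phi(g1) /\ g1^*(psi(g2)). *)
Definition hopf_source (b : forms M) (g : G) : forms M := b.
Definition hopf_target (b : forms M) (g : G) : forms M := star g b.
Definition hopf_unit (g : G) : forms M := hopf_source form_one g.
Definition hopf_mul (a a' : G -> forms M) (g : G) : forms M :=
  wedge (a g) (a' g).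
Definition hopf_coproduct (a : G -> forms M) (g1 g2 : G) : forms M :=
  a (g1 * g2)%g.
Definition hopf_counit (a : G -> forms M) : forms M := a 1%g.
Definition hopf_antipode (a : G -> forms M) (g : G) : forms M :=
  star g (a g^-1%g).

Fixpoint tensor (p : nat) : ('I_p -> G -> forms M) -> cochain p :=
  match p with
  | 0 => fun _ _ => form_one
  | p'.+1 => fun a g =>
      wedge (a ord0 (g ord0))
        (star (g ord0)
           (tensor (fun j => a (lift ord0 j)) (fun j => g (lift ord0 j))))
  end.

(* Insertion of a tensor factor 1 on the left. *)
Definition coface_first (p : nat) (phi : cochain p) : cochain p.+1 :=
  fun g => star (g ord0) (phi (fun j => g (lift ord0 j))).
(* Delta applied to the factor of index i, counted from 0. *)
Definition coface_mid (p : nat) (i : 'I_p) (phi : cochain p) : cochain p.+1 :=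
  fun g => hopf_coproduct
    (fun h => phi (fun j => if (j < i)%N then g (lift ord_max j)
                            else if j == i then h else g (lift ord0 j)))
    (g (lift ord_max i)) (g (lift ord0 i)).
(* Insertion of a tensor factor 1 on the right. *)
Definition coface_last (p : nat) (phi : cochain p) : cochain p.+1 :=
  fun g => phi (fun j => g (lift ord_max j)).
Definition coface (p : nat) (i : 'I_p.+2) : cochain p -> cochain p.+1 :=
  match unlift ord0 i with
  | None => @coface_first p
  | Some i' => match unlift ord_max i' with
    | None => @coface_last p
    | Some k => coface_mid k
    end
  end.

(* The counit applied to the factor of index i, counted from 0. *)
Definition codegeneracy (p : nat) (i : 'I_p.+1) (phi : cochain p.+1) :
    cochain p :=
  fun g => hopf_counit
    (fun h => phi (fun j => if unlift i j is Some j' then g j' else h)).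

(* On a tensor a^1 * ... * a^n this is
   (Delta^{n-1} S(a^1)) (a^2 * ... * a^n * 1): see cyclic_op_tensor. *)
Definition cyclic_op (p : nat) : cochain p -> cochain p :=
  match p with
  | 0 => id
  | p'.+1 => fun phi g => hopf_antipode
      (fun h => phi (fun j =>
         if unlift ord0 j is Some j' then g (lift ord_max j') else h))
      (\prod_(j < p'.+1) g j)%g
  end.

Definition hochschild_b (p : nat) (phi : cochain p) : cochain p.+1 :=
  \sum_(i < p.+2) (-1) ^+ i *: coface i phi.

Definition connes_B (p : nat) (phi : cochain p.+1) : cochain p :=
  let psi := codegeneracy ord_max
    (cyclic_op (phi - (-1) ^+ p.+1 *: cyclic_op phi)) in
  \sum_(i < p.+1) (-1) ^+ (p * i) *: iter i (@cyclic_op p) psi.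

(* The differential of differentiable group cohomology. *)
Definition group_d (p : nat) (c : cochain p) : cochain p.+1 := fun g =>
  star (g ord0) (c (fun j => g (lift ord0 j))) +
  \sum_(i < p) (-1) ^+ i.+1 *:
    c (fun j => if (j < i)%N then g (lift ord_max j)
                else if j == i then (g (lift ord_max j) * g (lift ord0 j))%g
                else g (lift ord0 j)) +
  (-1) ^+ p.+1 *: c (fun j => g (lift ord_max j)).

Fact coface_linear p (i : 'I_p.+2) : linear (@coface p i).
Proof.
by move=> a x y; rewrite /coface; case: (unlift _ _) => // k; case: (unlift _ _).
Qed.
Fact codegeneracy_linear p (i : 'I_p.+1) : linear (@codegeneracy p i).
Proof. by []. Qed.
Fact cyclic_op_linear p : linear (@cyclic_op p).
Proof. by case: p. Qed.

Fact hochschild_b_linear p : linear (@hochschild_b p).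
Proof.
move=> a x y; rewrite /hochschild_b scaler_sumr -big_split; apply: eq_bigr => i _.
by rewrite coface_linear scalerDr !scalerA (mulrC a).
Qed.

Fact iter_cyclic_op_linear p k : linear (iter k (@cyclic_op p)).
Proof. by move=> a x y; elim: k => //= k ->; rewrite cyclic_op_linear. Qed.

Fact connes_B_linear p : linear (@connes_B p).
Proof.
move=> a x y; rewrite /connes_B cyclic_op_linear.
set u := x - _ *: cyclic_op x; set v := y - _ *: cyclic_op y.
rewrite [X in cyclic_op X](_ : _ = a *: u + v); last first.
  by rewrite /u /v scalerDr scalerBr opprD !scalerA (mulrC a) addrACA.
rewrite cyclic_op_linear codegeneracy_linear scaler_sumr -big_split.
apply: eq_bigr => i _; rewrite iter_cyclic_op_linear.
by rewrite scalerDr !scalerA (mulrC a).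
Qed.

Fact group_d_linear p : linear (@group_d p).
Proof.
move=> a x y; apply/funext => g.
have E h : (a *: x + y) h = a *: x h + y h by [].
have starE h w w' : star h (a *: w + w') = a *: star h w + star h w' by [].
rewrite -[RHS]/(a *: group_d x g + group_d y g) /group_d !E starE.
rewrite !scalerDr scaler_sumr.
rewrite (eq_bigr _ (fun i _ => congr1 _ (E _))).
under eq_bigr do rewrite scalerDr scalerA (mulrC _ a) -scalerA.
rewrite big_split /= [X in X + _ = _]addrACA [LHS]addrACA.
by rewrite !scalerA (mulrC a).
Qed.

(* Total cochains are families indexed by p, of forms of all degrees q; the
   total degree is imposed by total_cochain. *)
Definition bicochain := dfam cochain.
HB.instance Definition _ := GRing.Lmodule.on bicochain.

Definition total_cochain (d : int) : set bicochain := fun x =>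
  (forall p, smooth_cochain (x p)) /\
  (forall p g q, (p + q)%N%:Z <> d -> x p g q = 0).

Definition total_d (delta : forall p, cochain p -> cochain p.+1)
    (x : bicochain) : bicochain := fun p =>
  match p with
  | 0 => cochain_d (x 0)
  | p'.+1 => delta p' (x p') + (-1) ^+ p'.+1 *: cochain_d (x p'.+1)
  end.

Fact total_cochain_zero d : total_cochain d 0.
Proof. by split=> // p; exact: smooth_cochain_zero. Qed.

Fact total_cochain_linear d a (x y : bicochain) :
  total_cochain d x -> total_cochain d y -> total_cochain d (a *: x + y).
Proof.
move=> [xs xd] [ys yd]; split=> [p|p g q pq].
  by apply: smooth_cochain_linear.
rewrite -[LHS]/(a *: x p g q + y p g q) xd // yd //.
by rewrite scaler0 addr0.
Qed.

Fact total_d_linear (delta : forall p, cochain p -> cochain p.+1) :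
  (forall p, linear (delta p)) ->
  forall d a (x y : bicochain), total_cochain d x -> total_cochain d y ->
  total_d delta (a *: x + y) = a *: total_d delta x + total_d delta y.
Proof.
move=> deltaL d a x y [xs _] [ys _]; apply/functional_extensionality_dep => -[|p].
  exact: cochain_d_linear.
rewrite -[LHS]/(delta p (a *: x p + y p) +
  (-1) ^+ p.+1 *: cochain_d (a *: x p.+1 + y p.+1)).
rewrite deltaL cochain_d_linear // scalerDr addrACA scalerA (mulrC _ a) -scalerA.
by rewrite -scalerDr.
Qed.

(* The (b, B)-complex: the component of index k of a cochain of degree d is a
   total cochain of degree d - 2k. *)
Definition cyclic_cochain (d : int) : set (nat -> bicochain) := fun y =>
  forall k, total_cochain (d - (2 * k)%N%:Z) (y k).

Definition cyclic_d (y : nat -> bicochain) : nat -> bicochain := fun k =>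
  total_d hochschild_b (y k) +
  match k with
  | 0 => 0
  | k'.+1 => (fun p => connes_B (y k' p.+1) : cochain p)
  end.

Fact cyclic_cochain_zero d : cyclic_cochain d 0.
Proof. by move=> k; exact: total_cochain_zero. Qed.

Fact cyclic_cochain_linear d a (x y : nat -> bicochain) :
  cyclic_cochain d x -> cyclic_cochain d y -> cyclic_cochain d (a *: x + y).
Proof. by move=> xc yc k; apply: total_cochain_linear. Qed.

Fact cyclic_d_linear d a (x y : nat -> bicochain) :
  cyclic_cochain d x -> cyclic_cochain d y ->
  cyclic_d (a *: x + y) = a *: cyclic_d x + cyclic_d y.
Proof.
move=> xc yc; apply/funext => k.
rewrite -[RHS]/(a *: cyclic_d x k + cyclic_d y k) /cyclic_d.
rewrite -[(a *: x + y) k]/(a *: x k + y k).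
rewrite (total_d_linear hochschild_b_linear a (xc k) (yc k)).
rewrite scalerDr addrACA; congr (_ + _).
case: k => [|k]; first by rewrite scaler0 addr0.
by apply/functional_extensionality_dep => p; exact: connes_B_linear.
Qed.

Definition cyclic_complex : complex R :=
  Complex cyclic_cochain_zero cyclic_cochain_linear cyclic_d_linear.

Definition group_complex : complex R :=
  Complex total_cochain_zero total_cochain_linear (total_d_linear group_d_linear).

(* HC^d(H(G, M)) *)
Definition cyclic_cohomology (d : int) : Type := cohomology cyclic_complex d.
HB.instance Definition _ d := GRing.Lmodule.on (cyclic_cohomology d).

(* H^d(G; (Omega^*(M), d)) *)
Definition differentiable_cohomology (d : int) : Type :=
  cohomology group_complex d.
HB.instance Definition _ d := GRing.Lmodule.on (differentiable_cohomology d).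

Lemma coface0_target (b : forms M) :
  coface (ord0 : 'I_2) (fun=> b : forms M) = fun g => hopf_target b (g ord0).
Proof. by rewrite /coface unlift_none. Qed.

Lemma coface0_source (b : forms M) :
  coface (ord_max : 'I_2) (fun=> b : forms M) = fun g => hopf_source b (g ord0).
Proof.
rewrite /coface; case: unliftP => [j e|/(congr1 val)//].
by rewrite (_ : j = ord_max) ?unlift_none //; apply: val_inj; case: j {e} => -[].
Qed.

Lemma coface_first_tensor p (a : 'I_p -> G -> forms M) :
  coface_first (tensor a) =
  tensor (fun j => if unlift ord0 j is Some k then a k else hopf_unit).
Proof.
apply/funext => g /=; rewrite unlift_none wedge1f; congr (star _ (tensor _ _)).
by apply/funext => j; rewrite liftK.
Qed.

Lemma coface_last_tensor p (a : 'I_p -> G -> forms M) :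
  coface_last (tensor a) =
  tensor (fun j => if unlift ord_max j is Some k then a k else hopf_unit).
Proof.
apply/funext => g; rewrite /coface_last; elim: p a g => [|p IH] a g /=.
  case: unliftP => [[]//|_]; rewrite /hopf_unit /hopf_source /star pullback_one.
  by rewrite wedge11.
have lm (k : 'I_p) : lift ord_max (lift ord0 k) = lift ord0 (lift ord_max k).
  by apply: val_inj; rewrite /= /bump /= !add1n ltnS addnS.
have l0 : lift (ord_max : 'I_p.+2) ord0 = ord0 by apply: val_inj.
have u0 : unlift ord_max (ord0 : 'I_p.+2) = Some ord0 by rewrite -[X in unlift _ X]l0 liftK.
rewrite u0 l0; congr (wedge _ (star _ _)).
rewrite (_ : (fun j => g (lift ord_max (lift ord0 j))) =
             (fun j => g (lift ord0 (lift ord_max j)))); last first.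
  by apply/funext => j; rewrite lm.
rewrite (IH (fun j => a (lift ord0 j)) (fun j => g (lift ord0 j))).
transitivity (tensor (fun j : 'I_p.+1 =>
    if unlift ord_max (lift ord0 j) is Some k then a k else hopf_unit)
  (fun j => g (lift ord0 j))); last by [].
apply: (congr1 (fun b => tensor b (fun j => g (lift ord0 j)))).
apply/funext => j; case: (unliftP ord_max j) => [k ->|->].
  by rewrite -lm liftK.
have -> : lift ord0 (ord_max : 'I_p.+1) = ord_max by apply: val_inj.
by rewrite !unlift_none.
Qed.

Hypothesis hact : smooth_action act.

Lemma act_diff g x :
  differentiable (chart_map (chart_at (act g x)) \o act g \o chart_inv (chart_at x))
    (chart_map (chart_at x) x).
Proof.
have [c [ac dc]] : exists c, @atlas R n G c /\ chart_dom c g by exact: atlas_cover.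
have [_ actS] := act_smooth hact.
have [_ [hc _] [cK _] _] := @atlas_chart R n G _ ac.
have [_ [hx _] [xK _] _] := @atlas_chart R m M _ (chart_at_atlas x).
have dx := chart_at_dom x.
have pac : prod_atlas (@atlas R n G) (@atlas R m M) (prod_chart c (chart_at x)).
  by exists c, (chart_at x); split => //; exact: chart_at_atlas.
have := actS _ _ pac (chart_at_atlas (act g x)) [::] (chart_map c g, chart_map (chart_at x) x).
set H := foldr _ _ _ => dH.
have -> : chart_map (chart_at (act g x)) \o act g \o chart_inv (chart_at x) =
   H \o (fun u => (chart_map c g, u)).
  by apply/funext => u; rewrite /H /= cK.
apply: differentiable_comp; first exact: differentiable_pair.
apply: dH; split => /=; first by split; [exact: hc|exact: hx].
by rewrite cK // xK //; exact: chart_at_dom.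
Qed.

Lemma act_continuous g : continuous (act g).
Proof.
move=> x; have [cact _] := act_smooth hact.
have -> : act g = (fun z : G * M => act z.1 z.2) \o (fun y => (g, y)) by [].
apply: continuous_comp; last exact: cact.
by apply: cvg_pair; [exact: cvg_cst|exact: cvg_id].
Qed.

Lemma near_chart (P : set M) x : nbhs x P ->
  \forall u \near chart_map (chart_at x) x, P (chart_inv (chart_at x) u).
Proof.
have [_ [hx _] [xK _] [_ xc]] := @atlas_chart R m M _ (chart_at_atlas x).
have dx := chart_at_dom x => xP.
by apply: (xc _ (hx _ dx) P); rewrite xK.
Qed.

Lemma starM g h w : star (g * h)%g w = star g (star h w).
Proof.
apply/functional_extensionality_dep => q; apply/funext => x; apply/funext => v.
rewrite /star /pullback invgM act_mul //; congr (w q _ _); apply/funext => i.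
set F := act g^-1%g; set F' := act h^-1%g.
set c := chart_at x; set c' := chart_at (F x); set c'' := chart_at (F' (F x)).
set B := chart_map c' \o F \o chart_inv c; set A := chart_map c'' \o F' \o chart_inv c'.
have dB : differentiable B (chart_map c x) by exact: act_diff.
have dA : differentiable A (chart_map c' (F x)) by exact: act_diff.
have [_ _ [xK _] _] := @atlas_chart R m M _ (chart_at_atlas x).
have [[oF _] _ [xFK _] _] := @atlas_chart R m M _ (chart_at_atlas (F x)).
have dx := chart_at_dom x.
have BE : B (chart_map c x) = chart_map c' (F x) by rewrite /B /= xK.
rewrite -[RHS]/('D_('D_(v i) B (chart_map c x)) A (chart_map c' (F x))).
rewrite -BE in dA *.
rewrite [RHS]deriveE // [X in 'd _ _ X]deriveE // -[RHS]/(('d A (B (chart_map c x)) \o 'd B (chart_map c x)) (v i)).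
rewrite -diff_comp // -deriveE; last exact: differentiable_comp.
apply: near_eq_derive.
have : nbhs x (F @^-1` chart_dom c').
  by apply: act_continuous; apply: open_nbhs_nbhs; split => //; exact: chart_at_dom.
move=> /near_chart; apply: filterS => u /= du.
by rewrite /A /B /= xFK // act_mul.
Qed.

Lemma star1 w : star 1%g w = w.
Proof.
apply/functional_extensionality_dep => q; apply/funext => x; apply/funext => v.
have a1 : act 1%g = id by apply/funext => y; rewrite act_one.
rewrite /star /pullback invg1 a1; congr (w q _ _); apply/funext => i.
have [[_ oc] [hx _] [_ uK] _] := @atlas_chart R m M _ (chart_at_atlas x).
rewrite (@near_eq_derive _ _ _ _ id) ?derive_id //.
have : nbhs (chart_map (chart_at x) x) (chart_cod (chart_at x)).
  by apply: open_nbhs_nbhs; split => //; apply: hx; exact: chart_at_dom.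
by apply: filterS => u /= cu; rewrite uK.
Qed.

Lemma cyclic_op_tensor p (a : 'I_p.+1 -> G -> forms M) (g : 'I_p.+1 -> G) :
  cyclic_op (tensor a) g =
  wedge (hopf_antipode (a ord0) (\prod_(j < p.+1) g j)%g)
    (tensor (fun j => if unlift ord_max j is Some k then a (lift ord0 k)
                      else hopf_unit) g).
Proof.
rewrite /cyclic_op; set P := (\prod_(j < _) _)%g.
rewrite /hopf_antipode /= unlift_none /star pullback_wedge.
rewrite -/(star P _) -/(star P^-1%g _) -/(star P (star _ _)); congr wedge.
rewrite -starM mulgV star1.
rewrite -[RHS](congr1 (@^~ g) (coface_last_tensor (fun k => a (lift ord0 k)))).
by congr (tensor _ _); apply/funext => j; rewrite liftK.
Qed.
End Cochains.

(* Main.v *)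
Require Import Defs.
From HB Require Import structures.
From mathcomp Require Import all_boot all_order all_algebra.
From mathcomp Require Import generic_quotient.
From mathcomp Require Import all_classical all_reals all_analysis.
Set Implicit Arguments.
Unset Strict Implicit.
Unset Printing Implicit Defensive.
Import GRing.Theory Num.Theory.
Local Open Scope ring_scope.

(** In homogeneous coordinates [F(x_0, ..., x_p) = x_0^* phi(x_0^-1 x_1, ..., x_(p-1)^-1 x_p)]
    the cofaces omit an entry, the codegeneracies repeat one, and the cyclic operator permutes
    the entries cyclically: the cocyclic module is dual to the sets [G^(p+1)], whose chain
    complex is contractible. By acyclic models there are operators [T_0 = 1, T_1, T_2, ...],
    with [T_j] lowering the degree by [2j], such that [b T_j = T_j b + T_(j-1) B]. The cone
    point used in the recursion is the first entry [x_0], so [T_j phi] is a linear combination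
    of functions [phi o w] in which [w] is a tuple of words in the group variables; no element
    of [G] acts on the forms. Hence [T_j] preserves smoothness, and it commutes with the de Rham
    differential [d] without any appeal to the naturality of [d]. The unitriangular operator
    [y |-> (sum_j T_j y_(k-j))_k] is therefore an automorphism of the graded space of
    cyclic cochains, and it carries the differential [b + d + B] to [b + d]. *)

(** * Homogeneous cochains as functions on sequences *)

Section SeqCochains.
Variables (R : comPzRingType) (X : Type) (V : lmodType R).
Implicit Types (F : seq X -> V) (w : seq X) (i n : nat).

(* The transposes of the operators of the cyclic vector space on words [x_0 ... x_p], of
   length [p.+1] and degree [p]; the complex is augmented by the empty word. *)
Definition del (T : Type) i (w : seq T) := take i w ++ drop i.+1 w.

Definition seq_face i F w : V := (-1) ^+ i *: F (del i w).
Definition seq_b F w : V := \sum_(i < size w) seq_face i F w.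
Definition seq_b' F w : V := \sum_(i < (size w).-1) seq_face i F w.
Definition seq_cycle F w : V := (-1) ^+ (size w).-1 *: F (rotr 1 w).
Definition seq_norm F w : V := \sum_(i < size w) iter i seq_cycle F w.
(** The extra degeneracy of the cyclic vector space, transposed: it copies the last entry to the
    front and contracts [seq_b'], the differential without the last face. *)
Definition seq_cone F w : V := if w is x :: s then F (last x s :: w) else 0.
Definition seq_B F : seq X -> V := seq_norm (seq_cone (F - seq_cycle F)).

Lemma size_del (T : Type) i (w : seq T) : (i < size w)%N -> size (del i w) = (size w).-1.
Proof.
move=> iw; rewrite size_cat size_take size_drop iw.
by case: (size w) iw => // n; rewrite ltnS subSS => /subnKC ->.
Qed.

Lemma nth_del (T : Type) (x0 : T) i (w : seq T) j :
  (i < size w)%N -> nth x0 (del i w) j = nth x0 w (bump i j).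
Proof.
move=> iw; rewrite nth_cat size_take iw /bump.
case: ltnP => ij; first by rewrite nth_take // leqNgt ij.
by rewrite nth_drop; congr (nth _ _ _); rewrite addSn subnKC // add1n.
Qed.

Lemma seq_cycle_linear : linear seq_cycle.
Proof.
move=> a F F'; apply/funext => w.
rewrite -[RHS]/(a *: seq_cycle F w + seq_cycle F' w) /seq_cycle.
by rewrite scalerA (mulrC a) -scalerA -scalerDr.
Qed.
HB.instance Definition _ := GRing.isLinear.Build R _ _ _ seq_cycle seq_cycle_linear.

Lemma seq_face_linear i : linear (seq_face i).
Proof.
move=> a F F'; apply/funext => w.
rewrite -[RHS]/(a *: seq_face i F w + seq_face i F' w) /seq_face.
by rewrite scalerA (mulrC a) -scalerA -scalerDr.
Qed.
HB.instance Definition _ i := GRing.isLinear.Build R _ _ _ (seq_face i) (seq_face_linear i).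

Lemma seq_b_linear : linear seq_b.
Proof.
move=> a F F'; apply/funext => w.
rewrite -[RHS]/(a *: seq_b F w + seq_b F' w) /seq_b scaler_sumr -big_split.
by apply: eq_bigr => i _; rewrite linearP.
Qed.
HB.instance Definition _ := GRing.isLinear.Build R _ _ _ seq_b seq_b_linear.

Lemma seq_b'_linear : linear seq_b'.
Proof.
move=> a F F'; apply/funext => w.
rewrite -[RHS]/(a *: seq_b' F w + seq_b' F' w) /seq_b' scaler_sumr -big_split.
by apply: eq_bigr => i _; rewrite linearP.
Qed.
HB.instance Definition _ := GRing.isLinear.Build R _ _ _ seq_b' seq_b'_linear.

Lemma iter_seq_cycle_linear i : linear (iter i seq_cycle).
Proof. by move=> a F F'; elim: i => //= i ->; rewrite linearP. Qed.

Lemma seq_norm_linear : linear seq_norm.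
Proof.
move=> a F F'; apply/funext => w.
rewrite -[RHS]/(a *: seq_norm F w + seq_norm F' w) /seq_norm scaler_sumr -big_split.
by apply: eq_bigr => i _; rewrite iter_seq_cycle_linear.
Qed.
HB.instance Definition _ := GRing.isLinear.Build R _ _ _ seq_norm seq_norm_linear.

Lemma seq_cone_linear : linear seq_cone.
Proof.
move=> a F F'; apply/funext => -[|x w] //.
by rewrite -[RHS]/(a *: 0 + 0 : V) scaler0 addr0.
Qed.
HB.instance Definition _ := GRing.isLinear.Build R _ _ _ seq_cone seq_cone_linear.

Lemma seq_B_linear : linear seq_B.
Proof.
by move=> a F F'; rewrite /seq_B linearP opprD addrACA -scalerBr !linearP.
Qed.
HB.instance Definition _ := GRing.isLinear.Build R _ _ _ seq_B seq_B_linear.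

(** The bound is the range in which [rotr i] is the [i]-th power of [rotr 1]; beyond the length the
    subtraction in [rotr] truncates. *)
Lemma iter_seq_cycleE i F w : (i <= size w)%N ->
  iter i seq_cycle F w = (-1) ^+ ((size w).-1 * i) *: F (rotr i w).
Proof.
elim: i F w => [|i IH] F w iw; first by rewrite muln0 expr0 scale1r /rotr subn0 rot_size.
rewrite iterSr IH ?(ltnW iw) // /seq_cycle scalerA -exprD size_rotr mulnS addnC.
congr (_ *: F _); set z := rotr 1 _.
have -> : w = rot i.+1 z by rewrite -addn1 rotD ?size_rotr ?addn1 // !rotrK.
by rewrite rotK.
Qed.

Lemma iter_seq_cycle_size F w : iter (size w) seq_cycle F w = F w.
Proof.
rewrite iter_seq_cycleE // /rotr subnn rot0 -signr_odd.
by case: (size w) => [|k]; rewrite oddM /= ?andbN scale1r.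
Qed.

Lemma seq_norm_cycle F : seq_norm (seq_cycle F) = seq_norm F.
Proof.
apply/funext => w; rewrite /seq_norm.
under eq_bigr do rewrite -iterSr.
case: w => [|x w]; first by rewrite !big_ord0.
rewrite -[size _]/(size w).+1 big_ord_recr [RHS]big_ord_recl addrC.
congr (_ + _); exact: (@iter_seq_cycle_size F (x :: w)).
Qed.

Lemma seq_cycle_norm F : seq_cycle (seq_norm F) = seq_norm F.
Proof.
rewrite -{2}seq_norm_cycle; apply/funext => w; rewrite /seq_cycle /seq_norm size_rotr.
rewrite scaler_sumr; apply: eq_bigr => i _.
by rewrite -iterSr iterS /seq_cycle.
Qed.

Lemma seq_BB F : seq_B (seq_B F) = 0.
Proof. by rewrite /seq_B seq_cycle_norm subrr !linear0. Qed.

Lemma del_rotr i w : (i.+1 < size w)%N -> del i.+1 (rotr 1 w) = rotr 1 (del i w).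
Proof.
case/lastP: w => [//|w x]; rewrite size_rcons ltnS => iw.
rewrite rotr1_rcons /del /= -cats1 take_cat drop_cat.
rewrite iw; case: ltnP => [iw'|wi].
  by rewrite catA cats1 rotr1_rcons.
have e : size w = i.+1 by apply/eqP; rewrite eqn_leq iw wi.
by rewrite e subnn drop0 cats1 rotr1_rcons -e drop_size cats0.
Qed.

Lemma seq_cycle_face i F w : (i.+1 < size w)%N ->
  seq_cycle (seq_face i.+1 F) w = seq_face i (seq_cycle F) w.
Proof.
move=> iw; rewrite /seq_cycle /seq_face size_del ?(ltnW iw) // !scalerA.
rewrite del_rotr //; congr (_ *: _).
by case: (size w) iw => // -[//|k] _ /=; rewrite !exprS !mulN1r mulrNN mulrC.
Qed.

Lemma seq_cycle_face0 F w : (0 < size w)%N ->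
  seq_cycle (seq_face 0 F) w = seq_face (size w).-1 F w.
Proof.
case/lastP: w => [//|w x] _; rewrite /seq_cycle /seq_face size_rcons expr0 scale1r.
rewrite rotr1_rcons /del take0 drop1 /= -cats1 take_size_cat //.
by rewrite drop_oversize ?cats0 // size_cat addn1.
Qed.

(** The signed faces satisfy [L D_(i+1) = D_i L] and [L D_0 = D_last], where [L] is [seq_cycle]: the
    last faces cancel and the others pair off into [seq_b']. *)
Lemma seq_cycle_b F : seq_b F - seq_cycle (seq_b F) = seq_b' (F - seq_cycle F).
Proof.
apply/funext => w; rewrite linearB /=.
rewrite -[LHS]/(seq_b F w - seq_cycle (seq_b F) w).
rewrite -[RHS]/(seq_b' F w - seq_b' (seq_cycle F) w).
case sw: (size w) => [|n].
  by rewrite (size0nil sw) /seq_cycle /seq_b /seq_b' !big_ord0 scaler0.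
have bE : seq_cycle (seq_b F) w = \sum_(i < n.+1) seq_cycle (seq_face i F) w.
  by rewrite /seq_cycle /seq_b size_rotr sw scaler_sumr.
rewrite bE /seq_b /seq_b' sw /= big_ord_recr big_ord_recl /=.
rewrite seq_cycle_face0 ?sw // addrKA.
congr (_ - _); apply: eq_bigr => i _.
by rewrite seq_cycle_face // sw ltnS.
Qed.

Lemma iter_cycle_face i F w : (i < size w)%N ->
  iter i seq_cycle (seq_face i F) w = seq_face 0 (iter i seq_cycle F) w.
Proof.
elim: i F w => [//|i IH] F w iw.
rewrite iterSr [in RHS]iterSr -IH ?(ltnW iw) //.
rewrite !iter_seq_cycleE ?(ltnW (ltnW iw)) //; congr (_ *: _).
by rewrite seq_cycle_face // size_rotr.
Qed.

Lemma eq_seq_norm F F' w : (forall v, size v = size w -> F v = F' v) ->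
  seq_norm F w = seq_norm F' w.
Proof.
move=> e; apply: eq_bigr => i _; rewrite !iter_seq_cycleE ?(ltnW (ltn_ord i)) //.
by rewrite e // size_rotr.
Qed.

Lemma iter_seq_cycle_norm i F : seq_norm (iter i seq_cycle F) = seq_norm F.
Proof. by elim: i => //= i <-; rewrite seq_norm_cycle. Qed.

Lemma iter_norm_seq_cycle i F : iter i seq_cycle (seq_norm F) = seq_norm F.
Proof. by elim: i => //= i ->; rewrite seq_cycle_norm. Qed.

(* Both sides are [N D_0 N], where [D_0] is the face deleting the first entry:
   signed faces satisfy [L D_(i+1) = D_i L], and [N] absorbs [L]. *)
Lemma seq_b_norm F : seq_b (seq_norm F) = seq_norm (seq_b' F).
Proof.
transitivity (seq_norm (seq_face 0 (seq_norm F))); apply/funext => w.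
  (* The extra rotation makes the powers run from 1 to [size w]; after reversal of the sum the power
     is [size w - i], which completes [iter i] to a full turn, the identity. *)
  rewrite -(seq_norm_cycle (seq_face _ _)) /seq_norm -/(seq_norm F).
  rewrite (reindex_inj rev_ord_inj) /=; apply: eq_bigr => i _.
  rewrite -iterSr -subSn // subSS.
  transitivity (iter (size w - i) seq_cycle (iter i seq_cycle (seq_face i (seq_norm F))) w).
    by rewrite -iterD subnK ?(ltnW (ltn_ord i)) // iter_seq_cycle_size.
  rewrite !(@iter_seq_cycleE (size w - i)) ?leq_subr //; congr (_ *: _).
  by rewrite iter_cycle_face ?size_rotr // iter_norm_seq_cycle.
(* The range of [seq_b'] depends on the length of its argument. As [seq_norm] at [w] sees words of
   one length only, the range can be frozen and the sum taken out by linearity. *)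
rewrite (@eq_seq_norm (seq_b' F) (\sum_(i < (size w).-1) seq_face i F)); last first.
  by move=> v vw; rewrite fct_sumE /seq_b' vw.
rewrite (@eq_seq_norm _ (\sum_(i < (size w).-1) seq_face 0 (iter i seq_cycle F))).
  rewrite !linear_sum !fct_sumE; apply: eq_bigr => i _ /=.
  rewrite -(iter_seq_cycle_norm i (seq_face i F)); apply: eq_seq_norm => v vw.
  rewrite iter_cycle_face // vw; case: i; case: (size w) => //= n i.
  exact: ltnW.
move=> v vw; rewrite fct_sumE /seq_face expr0 scale1r /seq_norm.
case: v vw => [|x v] <-; first by rewrite /= !big_ord0.
by rewrite size_del //=; apply: eq_bigr => i _; rewrite scale1r.
Qed.

(** Face 0 deletes the copied entry and returns [F w]. The other faces in [seq_b'] leave the last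
    entry in place, so they commute with the copying up to the sign of an index shift, and
    cancel. *)
Lemma seq_b'_cone F w : (0 < size w)%N ->
  seq_b' (seq_cone F) w + seq_cone (seq_b' F) w = F w.
Proof.
case: w => [//|x w] _.
rewrite -[seq_cone _ _]/(\sum_(i < (size w).+1) seq_face i F (last x w :: x :: w)).
have f0 : seq_face 0 F (last x w :: x :: w) = F (x :: w) by rewrite /seq_face scale1r.
rewrite big_ord_recl f0 addrCA -big_split big1 ?addr0 //.
move=> i _ /=; rewrite /seq_face exprS mulN1r scaleNr.
rewrite -[del (bump 0 i) _]/(last x w :: del i (x :: w)).
suff -> : seq_cone F (del i (x :: w)) = F (last x w :: del i (x :: w)) by rewrite subrr.
have : last x (del i (x :: w)) = last x w.
  rewrite /del last_cat /= -[in RHS](cat_take_drop i w) last_cat.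
  by have := ltn_ord i; rewrite -subn_gt0 -size_drop; case: drop.
have : size (del i (x :: w)) != 0.
  by rewrite size_del /= -?lt0n ?(leq_trans _ (ltn_ord i)) // ltnW // ltnS.
by case: (del i (x :: w)) => //= y v _ ->.
Qed.

(** With [L] the cycle, [N] the norm and [s] the cone, the sum is
    [N (b' s + s b') (1 - L) = N (1 - L) = 0]. *)
Lemma seq_bB F : seq_b (seq_B F) + seq_B (seq_b F) = 0.
Proof.
rewrite {2}/seq_B seq_cycle_b /seq_B seq_b_norm -linearD /=.
have e : seq_norm (F - seq_cycle F) = 0 by rewrite linearB /= seq_norm_cycle subrr.
rewrite -[RHS]e.
apply/funext => -[|x w]; first by rewrite /seq_norm !big_ord0.
by apply: eq_seq_norm => -[|y v] // _; apply: seq_b'_cone.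
Qed.

Definition seq_at (x : X) F w : V := F (x :: w).

Lemma seq_at_linear x : linear (seq_at x). Proof. by []. Qed.
HB.instance Definition _ x := GRing.isLinear.Build R _ _ _ (seq_at x) (seq_at_linear x).

Lemma seq_b_cons F x w : seq_b F (x :: w) = F w - seq_b (seq_at x F) w.
Proof.
rewrite /seq_b -[size _]/(size w).+1 big_ord_recl -sumrN; congr (_ + _).
  by rewrite /seq_face /del take0 scale1r /= drop0.
by apply: eq_bigr => i _; rewrite /seq_face exprS mulN1r scaleNr.
Qed.

Lemma seq_at_b x F : seq_at x (seq_b F) = F - seq_b (seq_at x F).
Proof. by apply/funext => w; exact: seq_b_cons. Qed.

Lemma seq_b0 F : seq_b F [::] = 0.
Proof. by rewrite /seq_b big_ord0. Qed.

(** Induction along the word through the homotopy [seq_at x] replaces the double sum over faces. *)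
Lemma seq_bb F : seq_b (seq_b F) = 0.
Proof.
apply/funext => w; elim: w F => [|x w IH] F; first exact: seq_b0.
rewrite seq_b_cons seq_at_b linearB /=.
by rewrite -[X in _ - X]/(seq_b F w - seq_b (seq_b _) w) IH subr0 subrr.
Qed.

Lemma eq_seq_b F F' w : (forall v, (size v).+1 = size w -> F v = F' v) ->
  seq_b F w = seq_b F' w.
Proof.
move=> e; apply: eq_bigr => i _; rewrite /seq_face e // size_del //.
by rewrite prednK // (leq_trans _ (ltn_ord i)).
Qed.

(** * The acyclic models recursion *)

Section Fill.
Variable S : (seq X -> V) -> seq X -> V.

(** Dually, the chain assigned to the simplex [x :: w] is the cone with vertex [x] over the cycle it
    has to bound. Since [seq_b] calls the recursion on words one entry shorter that are not subterms
    of [w], the counter [n] carries the length. *)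
Fixpoint seq_fill_rec n F w : V :=
  match n, w with
  | n'.+1, x :: _ =>
    seq_b (seq_fill_rec n' (seq_at x F)) w - S (seq_B (seq_at x F)) w
  | _, _ => 0
  end.
Definition seq_fill F w : V := seq_fill_rec (size w) F w.

Lemma seq_fill_cons F x w :
  seq_fill F (x :: w) =
  seq_b (seq_fill (seq_at x F)) (x :: w) - S (seq_B (seq_at x F)) (x :: w).
Proof.
rewrite {1}/seq_fill /=; congr (_ - _); apply: eq_seq_b => v /= [vw].
by rewrite /seq_fill vw.
Qed.

Hypothesis S_linear : linear S.
HB.instance Definition _ := GRing.isLinear.Build R _ _ _ S S_linear.

Lemma seq_fill_linear : linear seq_fill.
Proof.
move=> a F F'; apply/funext => w.
rewrite -[RHS]/(a *: seq_fill F w + seq_fill F' w).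
have [n] := ubnP (size w); elim: n w F F' => [//|n IH] [|x w] F F' /= wn.
  by rewrite /seq_fill scaler0 addr0.
rewrite !seq_fill_cons linearP.
rewrite (@eq_seq_b _ (a *: seq_fill (seq_at x F) + seq_fill (seq_at x F'))); last first.
  by move=> v /= [vw]; rewrite IH // vw.
by rewrite !linearP /= scalerDr addrACA.
Qed.

HB.instance Definition _ :=
  GRing.isLinear.Build R _ _ _ seq_fill seq_fill_linear.

Hypothesis SB0 : forall F, S (seq_B F) [::] = 0.
Hypothesis SbB : forall F, S (seq_b (seq_B F)) = seq_b (S (seq_B F)).

(* The transpose of the acyclic models argument: on a nonempty [x :: w], the
   operator [seq_at x] is a contracting homotopy of [seq_b]. *)
Lemma seq_fill_b F : seq_b (seq_fill F) = seq_fill (seq_b F) + S (seq_B F).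
Proof.
apply/funext => w; rewrite -[RHS]/(seq_fill (seq_b F) w + S (seq_B F) w).
have [n] := ubnP (size w); elim: n w F => [//|n IH] [|x w] F /= wn.
  by rewrite seq_b0 SB0 addr0.
rewrite (seq_fill_cons (seq_b F)) seq_at_b !linearB /=.
set sF := seq_at x F.
have -> : seq_B (seq_b sF) = - seq_b (seq_B sF).
  by apply/eqP; rewrite -addr_eq0 addrC seq_bB.
(* The induction hypothesis applies under the outer [seq_b], which reads words one entry shorter
   than [x :: w]; then [seq_b] squares to zero. *)
have e : seq_b (seq_fill (seq_b sF)) (x :: w) = - seq_b (S (seq_B sF)) (x :: w).
  rewrite (@eq_seq_b _ (seq_b (seq_fill sF) - S (seq_B sF))).
    by rewrite linearB /= seq_bb sub0r.
  move=> v /= [vw]; rewrite -[RHS]/(seq_b (seq_fill sF) v - S (seq_B sF) v).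
  by rewrite IH ?vw // addrK.
have -> : S (- seq_b (seq_B sF)) = - seq_b (S (seq_B sF)) by rewrite linearN /= SbB.
set A := seq_b (seq_fill F) _.
rewrite -[X in X + _ + _]/(A - seq_b (seq_fill (seq_b sF)) (x :: w)) e.
set C := S (seq_B F) _; set D := seq_b (S _) _.
rewrite -[X in _ = _ + X + _]/(- C - - - D) !opprK.
by rewrite [- C - D]addrC addrA addrK subrK.
Qed.

End Fill.

Fixpoint seq_T j : (seq X -> V) -> seq X -> V :=
  if j is j'.+1 then seq_fill (seq_T j') else id.

Lemma seq_T_linear j : linear (seq_T j).
Proof. by elim: j => //= j IH; exact: seq_fill_linear. Qed.

(** Each stage supplies the compatibility required by the next: on the image of [seq_B] the
    correction term contains [seq_B] twice and vanishes, so [seq_T j.+1] commutes there with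
    [seq_b]. *)
Lemma seq_T_bS j F : seq_b (seq_T j.+1 F) = seq_T j.+1 (seq_b F) + seq_T j (seq_B F).
Proof.
elim: j F => [|j IH] F.
  by rewrite [LHS]seq_fill_b // => {}F; rewrite /seq_B /seq_norm big_ord0.
apply: (seq_fill_b (seq_T_linear j.+1)) => // {}F.
have T0 : seq_T j 0 = 0.
  by have := seq_T_linear j (-1) 0 0; rewrite scaler0 addr0 scaleN1r addNr.
by rewrite IH seq_BB T0 addr0.
Qed.

End SeqCochains.

(** * Operators that substitute words in the positions of the argument *)

Section WordOperators.
Variables (R : comPzRingType) (X : Type) (V : lmodType R).
Implicit Types (O : (seq X -> V) -> seq X -> V) (F : seq X -> V).
Implicit Types (t : seq (R * seq nat)) (s : seq X) (u : seq nat).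

(** Positions out of range read [x]; reading thus commutes with maps of the entries and with
    substitution of words, without a bound on the positions. *)
Definition read_word (T : Type) (x : T) (s : seq T) u := [seq nth x (x :: s) i | i <- u].

Lemma read_word_iota (T : Type) (x : T) (s : seq T) : read_word x s (iota 0 (size s).+1) = x :: s.
Proof. by rewrite /read_word map_nth_iota0 // (take_size (x :: s)). Qed.

Lemma size_read_word (T : Type) (x : T) (s : seq T) u : size (read_word x s u) = size u.
Proof. exact: size_map. Qed.

(* On sequences with [a.+1] entries, [O F] is a fixed linear combination of values of [F]
   on sequences with [c.+1] entries, read off from the argument by words in its positions. *)
Definition word_op a c O := exists2 t,
  all (fun p => size p.2 == c.+1) t &
  forall F x s, size s = a ->
    O F (x :: s) = \sum_(p <- t) p.1 *: F (read_word x s p.2).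

Definition based_word_op a c O := exists2 t,
  all (fun p => size p.2 == c) t &
  forall F x s, size s = a ->
    O F (x :: s) = \sum_(p <- t) p.1 *: F (x :: read_word x s p.2).

Lemma based_word_opW a c O : based_word_op a c O -> word_op a c O.
Proof.
move=> [t tc tE]; exists [seq (p.1, 0%N :: p.2) | p <- t].
  by rewrite all_map; apply: sub_all tc => p /=.
by move=> F x s sa; rewrite tE // big_map.
Qed.

(** Precomposition with [seq_at x] puts the first entry in front of every word: the cone point makes
    the operators based. *)
Lemma word_op_at a c O O' : word_op a c O ->
  (forall F x s, size s = a -> O' F (x :: s) = O (seq_at x F) (x :: s)) ->
  based_word_op a c.+1 O'.
Proof. by move=> [t tc tE] e; exists t => // F x s sa; rewrite e // tE. Qed.

Lemma eq_word_op a c O O' : word_op a c O ->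
  (forall F x s, size s = a -> O' F (x :: s) = O F (x :: s)) -> word_op a c O'.
Proof. by move=> [t tc tE] e; exists t => // F x s sa; rewrite e // tE. Qed.

Lemma word_op_zero a c : word_op a c (fun _ _ => 0).
Proof. by exists [::] => // F x s _; rewrite big_nil. Qed.

Lemma word_op_linear a c (k : R) O O' : word_op a c O -> word_op a c O' ->
  word_op a c (fun F w => k *: O F w + O' F w).
Proof.
move=> [t tc tE] [t' tc' tE']; exists ([seq (k * p.1, p.2) | p <- t] ++ t').
  by rewrite all_cat all_map tc' andbT; apply: sub_all tc.
move=> F x s sa; rewrite big_cat big_map /= tE // tE' // scaler_sumr.
by congr (_ + _); apply: eq_bigr => p _; rewrite scalerA.
Qed.

Lemma word_op_sum a c (I : Type) (r : seq I) (O : I -> (seq X -> V) -> seq X -> V) :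
  (forall i, word_op a c (O i)) -> word_op a c (fun F w => \sum_(i <- r) O i F w).
Proof.
move=> Oc; elim: r => [|i r IH].
  by apply: eq_word_op (word_op_zero a c) _ => F x s _; rewrite big_nil.
apply: eq_word_op (word_op_linear 1 (Oc i) IH) _ => F x s _.
by rewrite big_cons scale1r.
Qed.

Lemma word_op_comp a c e O O' : word_op a c O -> word_op c e O' ->
  word_op a e (fun F => O (O' F)).
Proof.
move=> [t tc tE] [t' tc' tE'].
(* The word [p'.2] is read in the word [p.2], which is nonempty and is split into first letter and
   rest to fit [read_word]. *)
exists [seq (p.1 * p'.1, read_word (head 0%N p.2) (behead p.2) p'.2) | p <- t, p' <- t'].
  apply/allP => _ /allpairsP[[p p'] [_ /(allP tc') p't ->]] /=.
  by rewrite (size_read_word (head 0%N p.2)); exact: p't.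
move=> F x s sa; rewrite tE // big_allpairs_dep /=.
rewrite big_seq [RHS]big_seq; apply: eq_bigr => -[k u] /(allP tc) /=.
case: u => [//|i u]; rewrite eqSS => /eqP uc /=.
rewrite tE' ?size_map // scaler_sumr; apply: eq_bigr => p' _.
rewrite scalerA; congr (_ *: F _); rewrite /read_word -map_comp.
apply: eq_map => j; rewrite -[RHS]/(nth x (x :: s) (nth i (i :: u) j)).
rewrite -[LHS]/(nth (nth x (x :: s) i) (map (nth x (x :: s)) (i :: u)) j).
have [ju|uj] := ltnP j (size (i :: u)); first by rewrite (nth_map i).
by rewrite (nth_default i uj) nth_default //= size_map.
Qed.

(** A Yoneda argument: a rearrangement natural in the type of the entries is determined by its
    effect on the word of positions [0, ..., a]. *)
Lemma word_op_natural a c (phi : forall T : Type, seq T -> seq T) :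
  (forall (T T' : Type) (f : T -> T') w, map f (phi T w) = phi T' (map f w)) ->
  (forall w : seq nat, size w = a.+1 -> size (phi nat w) = c.+1) ->
  word_op a c (fun F w => F (phi X w)).
Proof.
move=> phiN phiS; exists [:: (1, phi nat (iota 0 a.+1))].
  by apply/andP; split=> //; apply/eqP; apply: phiS; rewrite size_iota.
move=> F x s <-; rewrite big_seq1 scale1r.
by rewrite /read_word phiN -/(read_word x s _) read_word_iota.
Qed.

Lemma word_op_id a : word_op a a id.
Proof. by apply: (@word_op_natural a a (fun=> id)). Qed.

Lemma word_op_face a i : (i < a.+2)%N -> word_op a.+1 a (seq_face i).
Proof.
move=> ia; have H : word_op a.+1 a (fun F w => F (del i w)).
  apply: (@word_op_natural a.+1 a (fun T => @del T i)) => [T T' f w|w wa].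
    by rewrite map_cat map_take map_drop.
  by rewrite size_del wa.
apply: eq_word_op (word_op_linear ((-1) ^+ i) H (word_op_zero _ _)) _.
by move=> F x s _; rewrite addr0.
Qed.

Lemma word_op_b a : word_op a.+1 a (@seq_b R X V).
Proof.
apply: eq_word_op (word_op_sum (index_enum 'I_a.+2) (fun i => word_op_face (ltn_ord i))) _.
by move=> F x s sa; rewrite /seq_b /= sa.
Qed.

Lemma word_op_cycle a : word_op a a (@seq_cycle R X V).
Proof.
have H : word_op a a (fun F w => F (rotr 1 w)).
  apply: (@word_op_natural a a (fun T => @rotr T 1)) => [T T' f w|w wa].
    by rewrite map_rotr.
  by rewrite size_rotr.
apply: eq_word_op (word_op_linear ((-1) ^+ a) H (word_op_zero _ _)) _.
by move=> F x s sa; rewrite addr0 /seq_cycle /= sa.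
Qed.

Lemma word_op_norm a : word_op a a (@seq_norm R X V).
Proof.
have H i : word_op a a (iter i (@seq_cycle R X V)).
  elim: i => [|i IH]; first exact: word_op_id.
  exact: eq_word_op (word_op_comp (word_op_cycle a) IH) _.
apply: eq_word_op (word_op_sum (index_enum 'I_a.+1) H) _.
by move=> F x s sa; rewrite /seq_norm /= sa.
Qed.

Lemma word_op_cone a : word_op a a.+1 (@seq_cone R X V).
Proof.
pose phi T (w : seq T) := if w is x :: s then last x s :: w else w.
have H : word_op a a.+1 (fun F w => F (phi X w)).
  by apply: word_op_natural => [T T' f [|x s] //=|[|x s] //= [->]] //; rewrite last_map.
exact: eq_word_op H _.
Qed.

Lemma word_op_B a : word_op a a.+1 (@seq_B R X V).
Proof.
apply: eq_word_op (word_op_comp (word_op_norm a) (word_op_comp (word_op_cone a)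
  (word_op_linear (-1) (word_op_cycle _) (word_op_id _)))) _.
move=> F x s _; rewrite /seq_B; congr (seq_norm (seq_cone _) _).
by apply/funext => w; rewrite scaleN1r addrC.
Qed.

(** A filling raises the degree by two more than [S] does: one for [seq_B] and one for the cone
    point. The induction on [a] follows the recursion on the length. *)
Lemma based_word_op_fill (S : (seq X -> V) -> seq X -> V) k :
  (forall a, word_op a (a + k)%N S) ->
  forall a, based_word_op a (a + k.+2)%N (seq_fill S).
Proof.
move=> Sk.
have SB a : word_op a (a + k.+1)%N (fun F => S (seq_B F)).
  by rewrite addnS; apply: word_op_comp (Sk a) _; exact: word_op_B.
elim=> [|a IH].
  apply: (word_op_at (word_op_linear (-1) (SB 0%N) (word_op_zero _ _))) => F x [|//] _.
  rewrite seq_fill_cons seq_b_cons seq_b0.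
  by rewrite /seq_fill /= subr0 sub0r scaleN1r addr0.
have H := word_op_comp (word_op_b a) (based_word_opW IH).
have SBa := SB a.+1; rewrite addSnnS in SBa.
apply: (word_op_at (word_op_linear (-1) SBa H)) => F x s sa.
by rewrite seq_fill_cons scaleN1r addrC.
Qed.

Lemma based_word_op_T j a : based_word_op a (a + j.*2)%N (@seq_T R X V j).
Proof.
elim: j a => [|j IH] a.
  exists [:: (1, iota 1 a)]; first by rewrite /= size_iota addn0 eqxx.
  move=> F x s <-; rewrite big_seq1 scale1r /=.
  congr (F _); exact: esym (read_word_iota x s).
by apply: based_word_op_fill => {}a; exact: based_word_opW.
Qed.

End WordOperators.

(** * The cocyclic module in homogeneous coordinates *)

Section Homogeneous.
Variables (R : realType) (n m : nat) (G : lieGroupType R n) (M : manifoldType R m).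
Variable act : G -> M -> M.
Hypothesis hact : smooth_action act.
Implicit Types (w s : seq G) (x y : bicochain G M).

Lemma star_linear (g : G) : linear (@star R n m G M act g).
Proof. by []. Qed.
HB.instance Definition _ g :=
  GRing.isLinear.Build R _ _ _ (@star R n m G M act g) (star_linear g).

(* The homogeneous form of a cochain is [homog x [:: x_0; ...; x_p]]; its inverse evaluates
   at [1, g_1, g_1 g_2, ...], which is [1 :: products g]. *)
Definition quotient_seq w (j : nat) : G := ((nth 1%g w j)^-1 * nth 1%g w j.+1)%g.

Definition homog x w : forms M :=
  if w is g :: s then star act g (x (size s) (fun j => quotient_seq w j)) else 0.

Lemma homogE x w p : size w = p.+1 ->
  homog x w = star act (nth 1%g w 0) (x p (fun j => quotient_seq w j)).
Proof. by case: w => //= g s [<-]. Qed.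

Lemma homog_linear : linear homog.
Proof.
move=> a x y; apply/funext => -[|g s]; first by rewrite -[RHS]/(a *: 0 + 0) scaler0 addr0.
exact: (star_linear g).
Qed.
HB.instance Definition _ := GRing.isLinear.Build R _ _ _ homog homog_linear.

Definition products p (g : 'I_p -> G) : seq G := scanl *%g 1%g [seq g i | i <- enum 'I_p].

Lemma size_products p (g : 'I_p -> G) : size (products g) = p.
Proof. by rewrite size_scanl size_map size_enum_ord. Qed.

Lemma quotient_seq_products p (g : 'I_p -> G) (j : 'I_p) :
  quotient_seq (1%g :: products g) j = g j.
Proof.
set s := [seq g i | i <- enum 'I_p].
have sp : size s = p by rewrite size_map size_enum_ord.
have E k : (k <= p)%N -> nth 1%g (1%g :: products g) k = foldl *%g 1%g (take k s).
  by case: k => [|k] kp; rewrite ?take0 //= nth_scanl // sp.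
rewrite /quotient_seq !E // ?(ltnW (ltn_ord j)) // (take_nth 1%g) ?sp //.
rewrite foldl_rcons mulKg (nth_map j) ?size_enum_ord //.
by rewrite nth_ord_enum.
Qed.

(** Evaluation on [1 :: products g] returns the cochain, as [star 1] is the identity. Identities
    between operators on cochains can thus be checked in homogeneous form. *)
Lemma homog_inj : injective homog.
Proof.
move=> x y e; apply/functional_extensionality_dep => p; apply/funext => g.
have := congr1 (@^~ (1%g :: products g)) e.
rewrite !(@homogE _ _ p) /= ?size_products // !(star1 hact).
by have -> : (fun j : 'I_p => quotient_seq (1%g :: products g) j) = g
  by apply/funext => j; exact: quotient_seq_products.
Qed.

Definition tot_b x : bicochain G M :=
  fun p => if p is p'.+1 then hochschild_b act (x p') else 0.
Definition tot_B x : bicochain G M := fun p => connes_B act (x p.+1).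

(** Deleting an inner entry multiplies the two adjacent quotients, which is the coproduct. Deleting
    [x_0] is absorbed by [star x_0 (star (x_0^-1 x_1) _) = star x_1 _], and deleting the last entry
    drops the last quotient. *)
Lemma star_coface x p (i : 'I_p.+2) w : size w = p.+2 ->
  star act (nth 1%g w 0) (coface act i (x p) (fun j => quotient_seq w j)) =
  homog x (del i w).
Proof.
move=> sw; rewrite (@homogE _ _ p) ?size_del ?sw //.
have q j : quotient_seq (del i w) j =
    ((nth 1%g w (bump i j))^-1 * nth 1%g w (bump i j.+1))%g.
  by rewrite /quotient_seq !nth_del ?sw.
rewrite nth_del ?sw // /coface; case: unliftP => [i' ei|ei]; last first.
  rewrite ei in q *; rewrite /coface_first -(starM hact).
  rewrite mulVKg.
  congr (star _ _ (x p _)); apply/funext => j.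
  by rewrite q.
have -> : bump i 0 = 0%N by rewrite ei.
case: unliftP => [k ek|ek]; congr (star _ _ _); last first.
  rewrite /coface_last; congr (x p _); apply/funext => j.
  rewrite q ei ek /quotient_seq /= /bump /= add1n ltnS [(p <= j)%N]leqNgt ltn_ord.
  by rewrite [(p < j)%N]ltnNge (ltnW (ltn_ord j)).
have ik : i = k.+1 :> nat.
  by rewrite ei ek /= /bump /= [(p <= k)%N]leqNgt ltn_ord.
rewrite /coface_mid /hopf_coproduct; congr (x p _); apply/funext => j.
rewrite q ik /quotient_seq /= /bump /= [(p <= j)%N]leqNgt [(p <= k)%N]leqNgt !ltn_ord /= !ltnS.
rewrite -val_eqE; case: (ltngtP j k) => // /val_inj ->.
by rewrite mulgA mulgK.
Qed.

Lemma homog_b x : homog (tot_b x) = seq_b (homog x).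
Proof.
apply/funext => -[|g [|g' s]]; first by rewrite seq_b0.
  (* In degree 0 the vanishing augmentation [homog x [::]] matches the zero component of [tot_b]. *)
  by rewrite seq_b_cons seq_b0 subr0 /= linear0.
rewrite (@homogE _ _ (size s).+1) // /tot_b /hochschild_b /seq_b.
rewrite fct_sumE linear_sum; apply: eq_bigr => i _.
by rewrite /seq_face -star_coface // linearZ.
Qed.

Definition tot_cycle x : bicochain G M := fun p => (-1) ^+ p *: cyclic_op act (x p).
Definition tot_cone x : bicochain G M :=
  fun p => codegeneracy ord_max (cyclic_op act (x p.+1)).

Lemma prod_quotient_seq w p :
  (\prod_(j < p) quotient_seq w j)%g = ((nth 1%g w 0)^-1 * nth 1%g w p)%g.
Proof.
elim: p => [|p IH]; first by rewrite big_ord0 mulVg.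
by rewrite big_ord_recr /= IH /quotient_seq mulgA mulgK.
Qed.

(** The quotients multiply to [x_0^-1 x_p], so the antipode turns [star x_0] into [star x_p] and
    inserts the inverse product [x_p^-1 x_0] as first variable. *)
Lemma star_cyclic x p w : size w = p.+1 ->
  star act (nth 1%g w 0) (cyclic_op act (x p) (fun j => quotient_seq w j)) =
  homog x (rotr 1 w).
Proof.
case/lastP: w => // s z; rewrite size_rcons => -[sp].
rewrite rotr1_rcons (@homogE _ _ p) /=; last by rewrite sp.
case: p sp => [|p] sp.
  by rewrite (size0nil sp) /=; congr (star _ _ (x 0%N _)); apply/funext => -[].
rewrite /cyclic_op /hopf_antipode -(starM hact) prod_quotient_seq mulVKg.
have -> : nth 1%g (rcons s z) p.+1 = z by rewrite nth_rcons sp ltnn eqxx.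
congr (star _ _ (x _ _)); apply/funext => j.
case: unliftP => [k ->|->].
  rewrite /quotient_seq /= /bump /= [(p <= k)%N]leqNgt ltn_ord add1n add0n.
  by rewrite !nth_rcons sp !ltnS ltn_ord (ltnW (ltn_ord k)).
rewrite invgM invgK /quotient_seq /=; congr (_ * _)%g.
by rewrite nth_rcons sp.
Qed.

Lemma homog_cycle x : homog (tot_cycle x) = seq_cycle (homog x).
Proof.
apply/funext => -[|g s]; first by rewrite /seq_cycle scaler0.
rewrite (@homogE _ _ (size s)) // /seq_cycle -(@star_cyclic _ (size s)) //.
Qed.

(** The counit sets the last group variable to 1, which repeats the last entry of the sequence; the
    cyclic operator carries the copy to the front. *)
Lemma homog_cone x : homog (tot_cone x) = seq_cone (homog x).
Proof.
apply/funext => -[//|g s].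
have -> : seq_cone (homog x) (g :: s) = homog x (rotr 1 (rcons (g :: s) (last g s))).
  by rewrite rotr1_rcons.
rewrite -(@star_cyclic _ (size s).+1) ?size_rcons //.
rewrite (@homogE _ _ (size s)) // /tot_cone /codegeneracy /hopf_counit.
congr (star _ _ (cyclic_op _ _ _)); apply/funext => j.
case: unliftP => [k ->|->].
  rewrite /quotient_seq /= /bump [(size s <= k)%N]leqNgt ltn_ord add0n.
  by rewrite -!rcons_cons !nth_rcons /= !ltnS ltn_ord (ltnW (ltn_ord k)).
rewrite /quotient_seq !nth_rcons /= ltnS leqnn ltnn eqxx.
by rewrite -last_nth mulVg.
Qed.

Lemma iter_tot_cycle i x p :
  iter i tot_cycle x p = (-1) ^+ (p * i) *: iter i (@cyclic_op R n m G M act p) (x p).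
Proof.
elim: i => [|i IH]; first by rewrite muln0 scale1r.
have cZ a (z : cochain G M p) : cyclic_op act (a *: z) = a *: cyclic_op act z.
  by case: p z {IH} => [|p] z.
by rewrite iterS {1}/tot_cycle IH cZ scalerA -exprD mulnS.
Qed.

Lemma homog_B x : homog (tot_B x) = seq_B (homog x).
Proof.
have -> : seq_B (homog x) = seq_norm (homog (tot_cone (x - tot_cycle x))).
  by rewrite homog_cone linearB /= homog_cycle.
set y := tot_cone _.
have cE i : iter i (@seq_cycle R _ _) (homog y) = homog (iter i tot_cycle y).
  by elim: i => //= i ->; rewrite homog_cycle.
apply/funext => -[|g s]; first by rewrite /seq_norm big_ord0.
rewrite /seq_norm; under [RHS]eq_bigr do rewrite cE (@homogE _ _ (size s)) //.
rewrite (@homogE _ _ (size s)) // /tot_B /connes_B fct_sumE linear_sum /=.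
apply: eq_bigr => i _; rewrite iter_tot_cycle.
by [].
Qed.

(* The words of [seq_T] start with the first entry of their argument, so no [star] is
   left when [seq_T] is transported to inhomogeneous cochains. *)
Definition T_words j p : seq (R * seq nat) :=
  projT1 (cid2 (@based_word_op_T R G (forms M) j p)).

Lemma T_wordsE j p (F : seq G -> forms M) (g : G) s : size s = p ->
  seq_T j F (g :: s) = \sum_(t <- T_words j p) t.1 *: F (g :: read_word g s t.2).
Proof. by rewrite /T_words; case: cid2 => t /= _ tE /tE ->. Qed.

Lemma size_T_words j p t : t \in T_words j p -> size t.2 = (p + j.*2)%N.
Proof. by rewrite /T_words; case: cid2 => r /= /allP H _ /H /eqP. Qed.

Definition word_subst p c (u : seq nat) (g : 'I_p -> G) (i : 'I_c) : G :=
  quotient_seq (1%g :: read_word 1%g (products g) u) i.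

Definition tot_T j x : bicochain G M := fun p g =>
  \sum_(t <- T_words j p) t.1 *: x (p + j.*2)%N (word_subst t.2 g).

Lemma quotient_seq_mul (g : G) w j : (j.+1 < size w)%N ->
  quotient_seq (map ( *%g g) w) j = quotient_seq w j.
Proof.
move=> jw; rewrite /quotient_seq !(nth_map 1%g) ?(ltnW jw) //.
by rewrite invgM mulgA mulgVK.
Qed.

Lemma products_quotient_seq (g : G) s :
  map ( *%g g) (1%g :: products (fun j : 'I_(size s) => quotient_seq (g :: s) j)) = g :: s.
Proof.
apply: (@eq_from_nth _ 1%g) => [|k]; rewrite size_map [size _]/= size_products // ltnS => ks.
rewrite (nth_map 1%g) /= ?size_products //.
elim: k ks => [|k IH] ks; first by rewrite /= mulg1.
have := quotient_seq_products (fun j : 'I_(size s) => quotient_seq (g :: s) j) (Ordinal ks).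
move=> /(canRL (mulVKg _)) ->; rewrite mulgA IH ?(ltnW ks) //.
by rewrite /quotient_seq mulVKg.
Qed.

(** Left translation by [g] takes the normalized sequence starting at 1 back to [g :: s], and
    quotients are left invariant. As the words keep the first entry, the same [star g] stands in
    front on both sides. *)
Lemma homog_T j x : homog (tot_T j x) = seq_T j (homog x).
Proof.
apply/funext => -[|g s]; first by case: j.
rewrite (T_wordsE _ _ _ (erefl (size s))) (@homogE _ _ (size s)) // linear_sum big_seq.
rewrite [RHS]big_seq; apply: eq_bigr => t /size_T_words st.
rewrite linearZ; congr (_ *: _).
rewrite (@homogE _ _ (size s + j.*2)%N) /=; last by rewrite size_read_word st.
congr (star _ _ (x _ _)); apply/funext => i; rewrite /word_subst.
set h := products _.
rewrite -(quotient_seq_mul g) /= ?size_read_word ?st ?ltnS //; congr (quotient_seq _ i).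
have := products_quotient_seq g s; rewrite -/h /= mulg1 => -[hs].
congr cons.
rewrite -[in RHS]hs /read_word -map_comp; apply: eq_map => k /=.
have -> : g :: map ( *%g g) h = map ( *%g g) (1%g :: h) by rewrite /= mulg1.
have [kh|hk] := ltnP k (size (1%g :: h)); first by rewrite (nth_map 1%g).
by rewrite !nth_default ?mulg1 ?size_map.
Qed.

Lemma tot_b_T j x :
  tot_b (tot_T j.+1 x) = tot_T j.+1 (tot_b x) + tot_T j (tot_B x).
Proof.
apply: homog_inj.
by rewrite linearD /= homog_b !homog_T homog_b homog_B seq_T_bS.
Qed.

Lemma tot_T0 x : tot_T 0 x = x.
Proof. by apply: homog_inj; rewrite homog_T. Qed.

Lemma tot_T_linear j : linear (tot_T j).
Proof.
move=> a x y; apply: homog_inj.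
by rewrite linearP /= !homog_T linearP /= seq_T_linear.
Qed.

End Homogeneous.
Arguments tot_T {R n m G M} j x p g : rename.
Arguments tot_b {R n m G M} act x p : rename.
Arguments tot_B {R n m G M} act x p : rename.

(** * Smoothness *)

Import numFieldNormedType.Exports.
Local Open Scope classical_set_scope.

Section FiniteSmoothness.
Variable R : realType.
Implicit Types V W Z : normedModType R.

(** Smoothness graded by order, so that the product and chain rules can be proved by induction on
    [k]. *)
Fixpoint Cn V W (U : set V) k (f : V -> W) : Prop :=
  (forall x, U x -> differentiable f x) /\
  if k is k'.+1 then forall v, Cn U k' ('D_v f) else True.

Lemma CinftyP V W (U : set V) (f : V -> W) : Cinfty U f <-> forall k, Cn U k f.
Proof.
split=> [fS k|fS vs x Ux].
  elim: k f fS => [|k IH] f fS; (have d := fS [::]); split=> // v.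
  (* [foldr] differentiates first along the last vector of the list, hence [rcons]. *)
  by apply: IH => vs x Ux; have := fS (rcons vs v) x Ux; rewrite foldr_rcons.
have {fS} := fS (size vs); elim/last_ind: vs f => [|vs v IH] f.
  by move=> [fd _]; exact: fd.
by rewrite size_rcons foldr_rcons => -[_ /(_ v)/IH].
Qed.

Lemma Cn_diff V W (U : set V) k (f : V -> W) x : Cn U k f -> U x -> differentiable f x.
Proof. by case: k => [|k] [fd _]; exact: fd. Qed.

Lemma CnW V W (U : set V) k (f : V -> W) : Cn U k.+1 f -> Cn U k f.
Proof.
elim: k f => [|k IH] f [fd fD]; first by split.
by split=> // v; apply: IH; exact: fD.
Qed.

Section Open.
Variables (V : normedModType R) (U : set V).
Hypothesis oU : open U.

Lemma eq_Cn W k (f g : V -> W) : (forall x, U x -> f x = g x) -> Cn U k f -> Cn U k g.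
Proof.
move=> fg; elim: k f g fg => [|k IH] f g fg [fd fD].
  split=> // x Ux; apply: near_eq_differentiable (fd x Ux).
  by have := open_nbhs_nbhs (conj oU Ux); apply: filterS.
split=> [x Ux|v].
  apply: near_eq_differentiable (fd x Ux).
  by have := open_nbhs_nbhs (conj oU Ux); apply: filterS.
apply: IH (fD v) => x Ux; apply: near_eq_derive.
by have := open_nbhs_nbhs (conj oU Ux); apply: filterS.
Qed.

Lemma CnD W k (f g : V -> W) : Cn U k f -> Cn U k g -> Cn U k (f + g).
Proof.
elim: k f g => [|k IH] f g fS gS;
  (have d x : U x -> differentiable (f + g) x
    by move=> Ux; apply: differentiableD; [exact: Cn_diff fS Ux|exact: Cn_diff gS Ux]);
  split=> // v.
have [_ /(_ v) fD] := fS; have [_ /(_ v) gD] := gS.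
apply: eq_Cn (IH _ _ fD gD) => x Ux; apply/esym/deriveD;
  by apply: diff_derivable; [exact: Cn_diff fS Ux || exact: Cn_diff gS Ux].
Qed.

Lemma Cn_cst W k (a : W) : Cn U k (cst a).
Proof.
elim: k a => [|k IH] a; split=> // v; rewrite (_ : 'D_v _ = cst 0) //.
by apply/funext => x; exact: derive_cst.
Qed.

Lemma Cn_sum W k (I : Type) (r : seq I) (f : I -> V -> W) :
  (forall i, Cn U k (f i)) -> Cn U k (\sum_(i <- r) f i).
Proof.
move=> fS; elim: r => [|i r IH]; first by rewrite big_nil; exact: (Cn_cst k 0).
by rewrite big_cons; exact: CnD.
Qed.

Lemma CnM k (f g : V -> R^o) : Cn U k f -> Cn U k g -> Cn U k (f * g : V -> R^o).
Proof.
elim: k f g => [|k IH] f g fS gS;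
  (have d x : U x -> differentiable (f * g : V -> R^o) x
    by move=> Ux; apply: differentiableM; [exact: Cn_diff fS Ux|exact: Cn_diff gS Ux]);
  split=> // v.
have [_ /(_ v) fD] := fS; have [_ /(_ v) gD] := gS.
apply: eq_Cn (CnD (IH _ _ (CnW fS) gD) (IH _ _ (CnW gS) fD)) => x Ux; apply/esym/deriveM;
  by apply: diff_derivable; [exact: Cn_diff fS Ux || exact: Cn_diff gS Ux].
Qed.

Lemma Cn_linear W Z k (L : W -> Z) (f : V -> W) :
  linear L -> continuous L -> Cn U k f -> Cn U k (L \o f).
Proof.
move=> Llin Lc.
pose LL : {linear W -> Z} := HB.pack L (GRing.isLinear.Build _ _ _ _ _ Llin).
have Ld y : differentiable L y by exact: (@linear_differentiable _ _ _ LL).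
elim: k f => [|k IH] f fS;
  (have d x : U x -> differentiable (L \o f) x
    by move=> Ux; apply: differentiable_comp => //; exact: Cn_diff fS Ux);
  split=> // v.
have [_ /(_ v) fD] := fS.
apply: eq_Cn (IH _ fD) => x Ux; have fd := Cn_diff fS Ux.
rewrite deriveE; last exact: differentiable_comp.
by rewrite diff_comp // (@diff_lin _ _ _ LL) //= deriveE.
Qed.

End Open.

(** Finite dimensionality in the form used by the chain rule: a derivative in a varying direction
    becomes a finite sum over fixed directions. *)
Definition coordinates W (I : finType) (e : I -> W) (c : I -> W -> R^o) : Prop :=
  (forall i, linear (c i) /\ continuous (c i)) /\ forall w, w = \sum_i c i w *: e i.

Definition has_coordinates W := exists I e c, @coordinates W I e c.

Lemma has_coordinates_real : has_coordinates (R^o : normedModType R).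
Proof.
exists unit, (fun=> 1), (fun=> id); split=> [_|w].
  by split=> // x; exact: cvg_id.
by rewrite (big_pred1 tt) ?[_ *: _]mulr1 // => -[].
Qed.

Lemma coordinates_matrix p q :
  @coordinates 'M[R]_(p, q) ('I_p * 'I_q)%type
    (fun ij => delta_mx ij.1 ij.2) (fun ij A => A ij.1 ij.2).
Proof.
split=> [ij|A]; last by rewrite {1}[A]matrix_sum_delta pair_bigA.
split=> [a A B|]; first by rewrite !mxE.
exact: coord_continuous.
Qed.

Lemma has_coordinates_matrix p q : has_coordinates ('M[R]_(p, q) : normedModType R).
Proof. by do 3!eexists; exact: coordinates_matrix. Qed.

Lemma has_coordinates_prod W Z :
  has_coordinates W -> has_coordinates Z -> has_coordinates (W * Z)%type.
Proof.
move=> [I [e [c [cl ce]]]] [J [e' [c' [cl' ce']]]].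
exists (I + J)%type, (fun k => match k with inl i => (e i, 0) | inr j => (0, e' j) end).
exists (fun k w => match k with inl i => c i w.1 | inr j => c' j w.2 end).
split=> [[i|j]|[w z]].
- have [l h] := cl i; split=> [a u v|x]; first exact: l.
  by apply: (@continuous_comp _ _ _ fst); [exact: cvg_fst|exact: h].
- have [l h] := cl' j; split=> [a u v|x]; first exact: l.
  by apply: (@continuous_comp _ _ _ snd); [exact: cvg_snd|exact: h].
rewrite big_sumType /=.
have -> : \sum_i c i w *: (e i, 0 : Z) = (w, 0).
  rewrite {2}[w]ce; elim/big_rec2: _ => // i y1 y2 _ ->.
  by congr (_, _); rewrite /= scaler0 addr0.
have -> : \sum_j c' j z *: (0 : W, e' j) = (0, z).
  rewrite {2}[z]ce'; elim/big_rec2: _ => // i y1 y2 _ ->.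
  by congr (_, _); rewrite /= scaler0 addr0.
by congr (_, _); rewrite /= ?addr0 ?add0r.
Qed.

Lemma Cn_coordinates V (U : set V) W (I : finType) (e : I -> W) c k (f : V -> W) : open U ->
  coordinates e c -> (forall i, Cn U k (c i \o f)) -> Cn U k f.
Proof.
move=> oU [cl ce] cf.
have -> : f = \sum_i ( *:%R^~ (e i) \o (c i \o f)).
  by apply/funext => x; rewrite fct_sumE {1}[f x]ce.
apply: Cn_sum => // i; apply: Cn_linear => //.
  by move=> a u v; rewrite scalerDl -scalerA.
exact: scalel_continuous.
Qed.

(** The derivative of the composite along [v] is the sum of the products of [c i ('D_v f)] with
    ['D_(e i) g] composed with [f]; both factors have order one less. *)
Lemma Cn_comp_real V W (U : set V) (U' : set W) k (f : V -> W) (g : W -> R^o) :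
  open U -> has_coordinates W -> (forall x, U x -> U' (f x)) ->
  Cn U k f -> Cn U' k g -> Cn U k (g \o f).
Proof.
move=> oU [I [e [c [cl ce]]]] fU.
elim: k g => [|k IH] g fS gS;
  (have d x : U x -> differentiable (g \o f) x
    by move=> Ux; apply: differentiable_comp; [exact: Cn_diff fS Ux|exact: Cn_diff gS (fU _ Ux)]);
  split=> // v.
have [_ /(_ v) fD] := fS; have [_ gD] := gS.
pose h := \sum_i (c i \o 'D_v f : V -> R^o) * (('D_(e i) g) \o f : V -> R^o).
have hS : Cn U k (h : V -> R^o).
  apply: (@Cn_sum _ _ oU R^o) => i; have [l lc] := cl i.
  apply: CnM => //; first exact: Cn_linear.
  by apply: IH; [exact: CnW fS|exact: gD].
apply: eq_Cn hS => // x Ux; have fd := Cn_diff fS Ux; have gd := Cn_diff gS (fU _ Ux).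
rewrite [RHS]deriveE; last exact: differentiable_comp.
rewrite diff_comp //= -[in RHS](deriveE v fd) [in RHS](ce ('D_v f x)) linear_sum /h fct_sumE.
apply: eq_bigr => i _; rewrite linearZ.
by rewrite -deriveE.
Qed.

Lemma Cinfty_comp V W Z (U : set V) (U' : set W) (f : V -> W) (g : W -> Z) :
  open U -> open U' -> has_coordinates W -> has_coordinates Z ->
  (forall x, U x -> U' (f x)) ->
  Cinfty U f -> Cinfty U' g -> Cinfty U (g \o f).
Proof.
move=> oU oU' Wc [I [e [c ec]]] fU /CinftyP fS /CinftyP gS; apply/CinftyP => k.
apply: (Cn_coordinates oU ec) => i; have [/(_ i)[l lc] _] := ec.
rewrite [_ \o _]compA; apply: Cn_comp_real fU (fS k) _ => //.
exact: Cn_linear.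
Qed.

Lemma Cinfty_pair V W Z (U : set V) (f : V -> W) (g : V -> Z) :
  open U -> Cinfty U f -> Cinfty U g -> Cinfty U (fun x => (f x, g x)).
Proof.
move=> oU /CinftyP fS /CinftyP gS; apply/CinftyP => k.
elim: k f g {fS gS}(fS k) (gS k) => [|k IH] f g fS gS;
  (have d x : U x -> differentiable (fun y => (f y, g y)) x
    by move=> Ux; apply: differentiable_pair; [exact: Cn_diff fS Ux|exact: Cn_diff gS Ux]);
  split=> // v.
have [_ /(_ v) fD] := fS; have [_ /(_ v) gD] := gS.
apply: eq_Cn (IH _ _ fD gD) => // x Ux.
have fd := Cn_diff fS Ux; have gd := Cn_diff gS Ux.
rewrite !deriveE //; last exact: differentiable_pair.
by rewrite diff_pair.
Qed.

Lemma Cinfty_coordinates V (U : set V) W (I : finType) (e : I -> W) c (f : V -> W) : open U ->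
  coordinates e c -> (forall i, Cinfty U (c i \o f)) -> Cinfty U f.
Proof.
move=> oU ec fS; apply/CinftyP => k; apply: (Cn_coordinates oU ec) => i.
by move: k; apply/CinftyP.
Qed.

Lemma Cinfty_linear_comp V W Z (U : set V) (L : W -> Z) (f : V -> W) : open U ->
  linear L -> continuous L -> Cinfty U f -> Cinfty U (L \o f).
Proof.
by move=> oU l lc /CinftyP fS; apply/CinftyP => k; exact: Cn_linear.
Qed.

Lemma eq_Cinfty V W (U : set V) (f g : V -> W) : open U ->
  (forall x, U x -> f x = g x) -> Cinfty U f -> Cinfty U g.
Proof.
by move=> oU fg /CinftyP fS; apply/CinftyP => k; exact: eq_Cn fg _.
Qed.

Lemma Cinfty_id V (U : set V) : Cinfty U id.
Proof.
apply/CinftyP => -[|k]; split=> // v.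
rewrite (_ : 'D_v id = cst v); first exact: Cn_cst.
by apply/funext => x; exact: derive_id.
Qed.

Lemma Cinfty_local V W (U : set V) (f : V -> W) :
  (forall x, U x -> exists2 U', U' x & Cinfty U' f) -> Cinfty U f.
Proof. by move=> H vs x /H[U' U'x fS]; exact: fS. Qed.

End FiniteSmoothness.

Lemma open_preimage_on (S T : topologicalType) (O : set S) (D : set T) (h : S -> T) :
  open O -> open D -> (forall z, O z -> {for z, continuous h}) -> open (O `&` h @^-1` D).
Proof.
move=> oO oD hc; rewrite openE => z [Oz Dz]; rewrite /interior; apply: filterI.
  by apply: open_nbhs_nbhs.
by apply: (hc z Oz D); apply: open_nbhs_nbhs.
Qed.

Lemma open_setprod (S T : topologicalType) (A : set S) (B : set T) :
  open A -> open B -> open (A `*` B).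
Proof.
move=> oA oB; rewrite openE => -[x y] [Ax By].
by exists (A, B) => //=; split; apply: open_nbhs_nbhs.
Qed.

(** * Smooth maps from open sets of normed spaces into manifolds *)

Section SmoothInto.
Variable R : realType.

(** What the composition lemmas require of an atlas; it also covers [prod_atlas], the source of the
    multiplication. *)
Definition good_atlas (T : topologicalType) (E : normedModType R) (A : set (chart T E)) :=
  (forall c, A c -> is_chart c) /\ (forall x, exists c, A c /\ chart_dom c x).

Definition smooth_into (V : normedModType R) (O : set V) (T : topologicalType)
    (E : normedModType R) (A : set (chart T E)) (h : V -> T) : Prop :=
  (forall z, O z -> {for z, continuous h}) /\
  forall c, A c -> Cinfty (O `&` h @^-1` chart_dom c) (chart_map c \o h).

Lemma good_atlas_manifold n (T : manifoldType R n) : good_atlas (@atlas R n T).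
Proof. by split; [exact: atlas_chart|exact: atlas_cover]. Qed.

Lemma is_chart_prod (T1 T2 : topologicalType) (E1 E2 : normedModType R)
    (c1 : chart T1 E1) (c2 : chart T2 E2) :
  is_chart c1 -> is_chart c2 -> is_chart (prod_chart c1 c2).
Proof.
move=> [[op1 op1'] [h1 h1'] [k1 k1'] [s1 s1']] [[op2 op2'] [h2 h2'] [k2 k2'] [s2 s2']].
split; split=> /=.
- exact: open_setprod.
- exact: open_setprod.
- by move=> x [] /= /h1 ? /h2 ?; split.
- by move=> x [] /= /h1' ? /h2' ?; split.
- by move=> [x y] [] /= /k1 -> /k2 ->.
- by move=> [x y] [] /= /k1' -> /k2' ->.
- move=> x [] /= /s1 ? /s2 ?; apply: cvg_pair => /=.
    by apply: (@continuous_comp _ _ _ fst) => //; exact: cvg_fst.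
  by apply: (@continuous_comp _ _ _ snd) => //; exact: cvg_snd.
- move=> x [] /= /s1' ? /s2' ?; apply: cvg_pair => /=.
    by apply: (@continuous_comp _ _ _ fst) => //; exact: cvg_fst.
  by apply: (@continuous_comp _ _ _ snd) => //; exact: cvg_snd.
Qed.

Lemma good_atlas_prod (T1 T2 : topologicalType) (E1 E2 : normedModType R)
    (A1 : set (chart T1 E1)) (A2 : set (chart T2 E2)) :
  good_atlas A1 -> good_atlas A2 -> good_atlas (prod_atlas A1 A2).
Proof.
move=> [A1c A1x] [A2c A2x]; split=> [_ [c1 [c2 [/A1c h1 /A2c h2 ->]]]|[x y]].
  exact: is_chart_prod.
have [c1 [h1 d1]] := A1x x; have [c2 [h2 d2]] := A2x y.
by exists (prod_chart c1 c2); split=> //; exists c1, c2.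
Qed.

Section OpenSource.
Variables (V : normedModType R) (O : set V).
Hypothesis oO : open O.

Lemma smooth_into_pair (T1 T2 : topologicalType) (E1 E2 : normedModType R)
    (A1 : set (chart T1 E1)) (A2 : set (chart T2 E2)) h1 h2 :
  good_atlas A1 -> good_atlas A2 -> smooth_into O A1 h1 -> smooth_into O A2 h2 ->
  smooth_into O (prod_atlas A1 A2) (fun z => (h1 z, h2 z)).
Proof.
move=> [A1c _] [A2c _] [h1c h1S] [h2c h2S].
have hc z : O z -> {for z, continuous (fun z => (h1 z, h2 z))}.
  by move=> Oz; apply: cvg_pair => /=; [exact: h1c|exact: h2c].
split=> // _ [c1 [c2 [a1 a2 ->]]].
have [[d1 _] _ _ _] := A1c _ a1; have [[d2 _] _ _ _] := A2c _ a2.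
apply: Cinfty_pair => [|vs z [Oz [z1 z2]]|vs z [Oz [z1 z2]]].
- by apply: open_preimage_on => //; exact: open_setprod.
- exact: h1S.
- exact: h2S.
Qed.

(** Smoothness is local: near [z0] a chart around [h z0] is inserted between [F] and [h], and the
    chain rule applies in coordinates. *)
Lemma smooth_into_comp (T1 T2 : topologicalType) (E1 E2 : normedModType R)
    (A1 : set (chart T1 E1)) (A2 : set (chart T2 E2)) (h : V -> T1) (F : T1 -> T2) :
  has_coordinates E1 -> has_coordinates E2 -> good_atlas A1 -> good_atlas A2 ->
  smooth_into O A1 h -> smooth_map A1 A2 F -> smooth_into O A2 (F \o h).
Proof.
move=> cE1 cE2 [A1c A1x] [A2c _] [hc hS] [Fc FS].
have Fhc z : O z -> {for z, continuous (F \o h)}.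
  by move=> Oz; apply: continuous_comp; [exact: hc|exact: Fc].
split=> // c2 a2; apply: Cinfty_local => z0 [Oz0 d2].
have [c1 [a1 d1]] := A1x (h z0).
have [[od1 oc1] [m1 _] [k1 _] [_ s1]] := A1c _ a1.
have [[od2 _] _ _ _] := A2c _ a2.
pose U := (O `&` (F \o h) @^-1` chart_dom c2) `&` (O `&` h @^-1` chart_dom c1).
exists U; first by [].
have oU : open U by apply: openI; exact: open_preimage_on.
have := FS _ _ a1 a2; set U' := _ `&` _ => cS.
have oU' : open U'.
  apply: open_preimage_on => // u cu; apply: continuous_comp; first exact: s1.
  exact: Fc.
have hSU : Cinfty U (chart_map c1 \o h) by move=> vs x [_ hx]; exact: hS.
apply: eq_Cinfty (Cinfty_comp oU oU' cE1 cE2 _ hSU cS) => // x [[_ x2] [_ x1]] /=.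
  by rewrite k1.
by split; [exact: m1|rewrite /= k1].
Qed.

Lemma smooth_into_cst (T : topologicalType) (E : normedModType R) (A : set (chart T E)) a :
  smooth_into O A (fun=> a).
Proof.
split=> [z _|c _]; first exact: cvg_cst.
by apply/CinftyP => k; exact: Cn_cst.
Qed.

Lemma smooth_into_chart_inv n (T : manifoldType R n) (L : V -> 'rV[R]_n) c :
  linear L -> continuous L -> @atlas R n T c -> (forall z, O z -> chart_cod c (L z)) ->
  smooth_into O (@atlas R n T) (chart_inv c \o L).
Proof.
move=> Ll Lc ac cL; have [[_ oc] _ _ [_ s]] := atlas_chart _ ac.
have hc z : O z -> {for z, continuous (chart_inv c \o L)}.
  by move=> Oz; apply: continuous_comp; [exact: Lc|apply: s; exact: cL].
split=> // c' ac'.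
have [[od _] _ _ _] := atlas_chart _ ac'.
have := atlas_compat _ _ ac ac'; set U' := _ `&` _ => cS.
have oU' : open U' by exact: open_preimage_on.
have oU : open (O `&` (chart_inv c \o L) @^-1` chart_dom c') by exact: open_preimage_on.
have cE := has_coordinates_matrix R 1 n.
apply: (Cinfty_comp oU oU' cE cE _ (f := L)) cS => [x [Ox dx]|]; last first.
  exact: Cinfty_linear_comp (@Cinfty_id _ _ _).
by split=> //; exact: cL.
Qed.

End OpenSource.
End SmoothInto.

(** * Smoothness of cochains under substitution of group words *)

Section SmoothSubstitution.
Variables (R : realType) (n m : nat) (G : lieGroupType R n) (M : manifoldType R m).

Definition chart_point p (c : 'I_p -> chart G 'rV[R]_n) (Z : 'M[R]_(p, n)) (i : 'I_p) : G :=
  chart_inv (c i) (row i Z).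

Definition chart_domain p (c : 'I_p -> chart G 'rV[R]_n) (e : chart M 'rV[R]_m) :=
  [set z : 'M[R]_(p, n) * 'rV[R]_m |
    (forall i, chart_cod (c i) (row i z.1)) /\ chart_cod e z.2].

(** The test domain is that of [smooth_cochain], with its coordinate on [M], so that words can be
    inserted into cochains directly. *)
Definition smooth_word p (f : ('I_p -> G) -> G) : Prop :=
  forall c e, (forall i, @atlas R n G (c i)) -> @atlas R m M e ->
    smooth_into (chart_domain c e) (@atlas R n G) (fun z => f (chart_point c z.1)).

Lemma smooth_word_cst p a : smooth_word (fun _ : 'I_p -> G => a).
Proof. by move=> c e ac ae; apply: smooth_into_cst; exact: open_cochain_domain. Qed.

Lemma smooth_word_proj p (i : 'I_p) : smooth_word (fun g => g i).
Proof.
move=> c e ac ae; rewrite /chart_point.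
apply: (@smooth_into_chart_inv _ _ _ _ n G (fun z => row i z.1)) => //.
- exact: open_cochain_domain.
- by move=> a u v; rewrite linearP.
- by move=> z; apply: (@continuous_comp _ _ _ fst); [exact: cvg_fst|exact: row_continuous].
- by move=> z [].
Qed.

Lemma smooth_word_mul p (f f' : ('I_p -> G) -> G) :
  smooth_word f -> smooth_word f' -> smooth_word (fun g => f g * f' g)%g.
Proof.
move=> fS fS' c e ac ae.
have cE := has_coordinates_matrix R 1 n.
have gG := @good_atlas_manifold R n G.
have oO := open_cochain_domain ac ae.
have H := smooth_into_pair oO gG gG (fS c e ac ae) (fS' c e ac ae).
exact: (smooth_into_comp oO (has_coordinates_prod cE cE) cE (good_atlas_prod gG gG) gG
  H smooth_mul).
Qed.

Lemma smooth_word_inv p (f : ('I_p -> G) -> G) :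
  smooth_word f -> smooth_word (fun g => (f g)^-1)%g.
Proof.
move=> fS c e ac ae.
have cE := has_coordinates_matrix R 1 n.
have gG := @good_atlas_manifold R n G.
exact: (smooth_into_comp (open_cochain_domain ac ae) cE cE gG gG (fS c e ac ae) smooth_inv).
Qed.

(** Near a point, charts [c' i] around the values of the words are chosen. The local expression is
    then that of [phi] in these charts, composed with the words in coordinates; the coordinate on
    [M] is left alone. *)
Lemma smooth_cochain_reindex p p' (f : ('I_p -> G) -> 'I_p' -> G) (phi : cochain G M p') :
  (forall i, smooth_word (fun g => f g i)) -> smooth_cochain phi ->
  smooth_cochain ((fun g => phi (f g)) : cochain G M p).
Proof.
move=> fS [phiA phiS]; split=> [g q x|q c e v ac ae]; first exact: phiA.
rewrite -/(chart_domain c e); have oO : open (chart_domain c e) := open_cochain_domain ac ae.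
apply: Cinfty_local => z0 Oz0.
pose c' i := projT1 (cid (atlas_cover (f (chart_point c z0.1) i))).
have ac' i : @atlas R n G (c' i) by rewrite /c'; case: cid => ? [].
have dc' i : chart_dom (c' i) (f (chart_point c z0.1) i) by rewrite /c'; case: cid => ? [].
pose D i := chart_domain c e `&` [set z | chart_dom (c' i) (f (chart_point c z.1) i)].
have oD i : open (D i).
  have [fc _] := fS i c e ac ae.
  by apply: open_preimage_on => //; have [[]] := atlas_chart _ (ac' i).
pose U := chart_domain c e `&` [set z | forall i, D i z].
have Uz0 : U z0 by split=> [//|i]; split=> //; exact: dc'.
have oU : open U.
  apply: openI => //; rewrite openE => z Dz; rewrite /interior.
  apply: (@filter_forall _ _ (fun i z => D i z) (nbhs z) _) => i.
  by apply: open_nbhs_nbhs; split.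
exists U; first exact: Uz0.
pose h z : 'M[R]_(p', n) * 'rV[R]_m :=
  (\matrix_(i, j) chart_map (c' i) (f (chart_point c z.1) i) ord0 j, z.2).
have cE a b := has_coordinates_matrix R a b.
have hU z : U z -> chart_domain c' e (h z).
  move=> [[_ ez] Dz]; split=> // i.
  have [_ [k _] _ _] := atlas_chart _ (ac' i).
  rewrite (_ : row i _ = chart_map (c' i) (f (chart_point c z.1) i)).
    by apply: k; have [_] := Dz i.
  by apply/rowP => j; rewrite !mxE.
have hS : Cinfty U h.
  apply: Cinfty_pair => //; last first.
    apply: (@Cinfty_linear_comp _ _ _ _ _ snd id) => //.
      by move=> z; exact: cvg_snd.
    exact: Cinfty_id.
  apply: (Cinfty_coordinates oU (@coordinates_matrix R p' n)) => -[i j] /=.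
  have [cl _] := @coordinates_matrix R 1 n; have [kl kc] := cl (ord0, j).
  have fU : Cinfty U (chart_map (c' i) \o (fun z => f (chart_point c z.1) i)).
    move=> vs z [Oz /(_ i)[_ dz]].
    by have [_ fiS] := fS i c e ac ae; exact: (fiS _ (ac' i)).
  by apply: eq_Cinfty (Cinfty_linear_comp oU kl kc fU) => // z _ /=; rewrite mxE.
have oO' : open (chart_domain c' e) := open_cochain_domain ac' ae.
have := phiS q c' e v ac' ae; rewrite -/(chart_domain c' e) => gS.
apply: eq_Cinfty (Cinfty_comp oU oO' (has_coordinates_prod (cE _ _) (cE _ _))
  (@has_coordinates_real R) hU hS gS) => // z [_ Dz] /=.
congr (local_form e (phi _ q) _ v); apply/funext => i.
have [_ _ [k _] _] := atlas_chart _ (ac' i).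
rewrite -[RHS]k; last by have [_] := Dz i.
by congr chart_inv; apply/rowP => j; rewrite !mxE.
Qed.

Lemma smooth_word_products p k : smooth_word (fun g : 'I_p -> G => nth 1%g (1%g :: products g) k).
Proof.
elim: k => [|k IH]; first exact: smooth_word_cst.
have [kp|pk] := ltnP k p; last first.
  rewrite (_ : (fun g => _) = (fun=> 1%g)); first exact: smooth_word_cst.
  by apply/funext => g; rewrite nth_default //= size_products ltnS.
have := smooth_word_mul IH (smooth_word_proj (Ordinal kp)).
congr smooth_word; apply/funext => g.
have := quotient_seq_products g (Ordinal kp).
by move=> /(canRL (mulVKg _)) ->.
Qed.

Lemma smooth_word_subst p c u (i : 'I_c) : smooth_word (fun g : 'I_p -> G => word_subst u g i).
Proof.
have H k : smooth_word (fun g : 'I_p -> G => nth 1%g (1%g :: read_word 1%g (products g) u) k).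
  case: k => [|k]; first exact: smooth_word_cst.
  have [ku|uk] := ltnP k (size u); last first.
    rewrite (_ : (fun g => _) = (fun=> 1%g)); first exact: smooth_word_cst.
    by apply/funext => g; rewrite nth_default //= size_read_word ltnS.
  have := @smooth_word_products p (nth 0%N u k).
  congr smooth_word; apply/funext => g.
  by rewrite /= (nth_map 0%N).
exact: smooth_word_mul (smooth_word_inv (H i)) (H i.+1).
Qed.

End SmoothSubstitution.

(** * Cohomology *)

Section CohomologyDirectSum.
Variables (R : pzRingType) (I : Type) (K : complex R) (L : I -> complex R).
Variables (phi : K -> forall i, L i) (c : I -> int) (d : int).
Hypothesis phi_inj : forall x y, (forall i, phi x i = phi y i) -> x = y.
Hypothesis phi_linear : forall a x y i, phi (a *: x + y) i = a *: phi x i + phi y i.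
Hypothesis phi_cochain : forall e x, complex_cochains e x ->
  forall i, complex_cochains (e - c i) (phi x i).
Hypothesis phi_onto : forall e (z : forall i, L i),
  (forall i, complex_cochains (e - c i) (z i)) ->
  exists2 x, complex_cochains e x & forall i, phi x i = z i.
Hypothesis phi_diff : forall e x, complex_cochains e x ->
  forall i, phi (complex_diff x) i = complex_diff (phi x i).
Hypothesis phi_finite :
  finite_set [set i | exists2 z : L i, complex_cochains (d - c i) z & z <> 0].

(** Total for convenience: the default 0 is taken off the cocycles, and only the values on cocycles
    matter. *)
Let cls i (z : L i) : cohomology (L i) (d - c i) := quot_class _ (insubd 0 z).

Let cls_val i (z : L i) : z \in cocycle (d - c i) ->
  submodule_val (insubd (0 : submodule (cocycle (K := L i) (d - c i))) z) = z.
Proof. by move=> zc; rewrite -[LHS]/(val _) val_insubd zc. Qed.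

Let phi_cocycle x : x \in cocycle (K := K) d -> forall i, phi x i \in cocycle (d - c i).
Proof.
move=> /asboolP[xc x0] i; apply/asboolP; split; first exact: phi_cochain.
rewrite -(phi_diff xc) x0.
by have := phi_linear (-1) 0 0 i; rewrite scaler0 addr0 scaleN1r addNr.
Qed.

Let cls_linear i a z z' : z \in cocycle (d - c i) -> z' \in cocycle (d - c i) ->
  @cls i (a *: z + z') = a *: @cls i z + @cls i z'.
Proof.
move=> zc zc'; rewrite [RHS](_ : _ = quot_class _ (a *: insubd 0 z + insubd 0 z')).
  congr quot_class; apply: val_inj; rewrite /= !cls_val //.
  by rewrite rpredD // rpredZ.
by rewrite quot_classD -quot_scaleE.
Qed.

Let cls_eq0 i (z : L i) : z \in cocycle (d - c i) ->
  @cls i z = 0 <-> exists2 w, complex_cochains (d - c i - 1) w & complex_diff w = z.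
Proof.
move=> zc; have e : quot_class (coboundary (K := L i) (d := d - c i)) 0 = 0.
  by rewrite /quot_class raddf0.
rewrite /cls -[X in _ = X]e; split.
  move/quot_classP; rewrite subr0 => /asboolP[w wc wz]; exists w => //.
  by rewrite wz cls_val.
move=> [w wc wz]; apply/quot_classP; rewrite subr0; apply/asboolP; exists w => //.
by rewrite wz cls_val.
Qed.

Let target := direct_sum (fun i => cohomology (L i) (d - c i)).

Let class_fun (x : K) : dfam (fun i => cohomology (L i) (d - c i)) :=
  fun i => @cls i (phi x i).

Let class_fun_finsupp x : x \in cocycle (K := K) d -> class_fun x \in @finsupp_pred _ _ _.
Proof.
move=> xc; apply/asboolP; apply: sub_finite_set phi_finite => i /= nz.
have /asboolP[pc _] := phi_cocycle xc i.
exists (phi x i) => // p0; apply: nz; apply/cls_eq0; first exact: phi_cocycle.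
exists 0; first exact: complex_cochains_zero.
by rewrite complex_diff0 p0.
Qed.

Let class_funE x : x \in cocycle (K := K) d -> forall i,
  submodule_val (insubd (0 : target) (class_fun x)) i = @cls i (phi x i).
Proof. by move=> xc i; rewrite -[submodule_val _]/(val _) val_insubd class_fun_finsupp. Qed.

Let coh (u : cohomology K d) : target :=
  insubd 0 (class_fun (submodule_val
    (repr (u : Quotient.quot (zmod_of_submod (coboundary (d := d))))))).

Let coh_class (x : submodule (cocycle (K := K) d)) i :
  submodule_val (coh (quot_class _ x)) i = @cls i (phi (submodule_val x) i).
Proof.
rewrite /coh class_funE; last exact: valP.
set y := repr _.
have /quot_classP/asboolP[w wc wxy] : quot_class (coboundary (d := d)) x = quot_class _ y.
  exact: quot_classE.
have xc := valP x; have yc := valP y.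
apply/esym/eqP; rewrite -subr_eq0.
have -> : @cls i (phi (submodule_val x) i) - @cls i (phi (submodule_val y) i) =
    -1 *: @cls i (phi (submodule_val y) i) + @cls i (phi (submodule_val x) i).
  by rewrite scaleN1r [RHS]addrC.
rewrite -cls_linear; try exact: phi_cocycle.
apply/eqP/cls_eq0.
  by rewrite rpredD ?rpredZ //; exact: phi_cocycle.
exists (phi w i); first by rewrite addrAC; exact: phi_cochain.
rewrite -(phi_diff wc) wxy -phi_linear; congr (phi _ i).
by rewrite scaleN1r addrC.
Qed.

Let coh_linear : linear coh.
Proof.
move=> a u v; apply: val_inj; apply/functional_extensionality_dep => i.
rewrite -[RHS]/(a *: submodule_val (coh u) i + submodule_val (coh v) i).
rewrite (quot_classE u) (quot_classE v); set x := repr _; set y := repr _.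
rewrite -[a *: _]/(quot_scale a _) quot_scaleE -quot_classD !coh_class.
rewrite -cls_linear; try exact/phi_cocycle/valP.
by rewrite [LHS]coh_class -phi_linear.
Qed.

(** Bounding cochains chosen in every component are assembled into a single one by [phi_onto] in
    degree [d - 1]. *)
Let coh_inj u v : coh u = coh v -> u = v.
Proof.
rewrite (quot_classE u) (quot_classE v); set x := repr _; set y := repr _ => e.
apply/quot_classP/asboolP.
have xc := valP x; have yc := valP y.
have H i : exists2 w, complex_cochains (d - c i - 1) w &
    complex_diff w = -1 *: phi (submodule_val y) i + phi (submodule_val x) i.
  apply/cls_eq0; first by rewrite rpredD ?rpredZ //; exact: phi_cocycle.
  rewrite cls_linear; try exact: phi_cocycle.
  by rewrite -!coh_class e scaleN1r addNr.
pose w i := s2val (cid2 (H i)).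
have [|z zc zw] := @phi_onto (d - 1) w.
  by move=> i; rewrite addrAC; exact: (s2valP (cid2 (H i))).
exists z => //; apply: phi_inj => i.
rewrite (phi_diff zc) zw (s2valP' (cid2 (H i))) -phi_linear; congr (phi _ i).
by rewrite scaleN1r addrC.
Qed.

Let coh_surj t : exists u, coh u = t.
Proof.
pose z i := submodule_val (repr
  (submodule_val t i : Quotient.quot (zmod_of_submod (coboundary (d := d - c i))))).
have zc i : z i \in cocycle (d - c i) by exact: valP.
have [x xc xz] : exists2 x, complex_cochains d x & forall i, phi x i = z i.
  by apply: phi_onto => i; have /asboolP[] := zc i.
(* The lift of a family of cocycles is a cocycle, because [phi] is injective and compatible with the
   differentials. *)
have x0 : complex_diff x = 0.
  apply: phi_inj => i; rewrite (phi_diff xc) xz.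
  have /asboolP[_ ->] := zc i.
  by have := phi_linear (-1) 0 0 i; rewrite scaler0 addr0 scaleN1r addNr.
have xC : x \in cocycle d by apply/asboolP.
exists (quot_class _ (SubModule xC)).
apply: val_inj; apply/functional_extensionality_dep => i.
rewrite [LHS]coh_class /= xz /cls [RHS]quot_classE; congr quot_class.
by apply: val_inj; exact: cls_val.
Qed.

(** An isomorphism of the cochains of [K] with families of cochains of the [L i] gives the product
    of the cohomologies; by [phi_finite] only finitely many factors are nonzero in degree [d], so it
    is the direct sum. *)
Lemma cohomology_direct_sum :
  exists f : {linear cohomology K d -> direct_sum (fun i => cohomology (L i) (d - c i))},
    bijective f.
Proof.
pose f : {linear cohomology K d -> target} :=
  HB.pack coh (GRing.isLinear.Build _ _ _ _ coh coh_linear).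
exists f; pose g t := projT1 (cid (coh_surj t)).
have gK t : coh (g t) = t by rewrite /g; case: cid.
by exists g => [u|t] //; apply: coh_inj; exact: gK.
Qed.

End CohomologyDirectSum.

(** * The comparison isomorphism of complexes *)

Section Comparison.
Variables (R : realType) (n m : nat) (G : lieGroupType R n) (M : manifoldType R m).
Variable act : G -> M -> M.
Hypothesis hact : smooth_action act.
Implicit Types (x : bicochain G M) (y z : nat -> bicochain G M) (d : int).

(** The first, inner and last cofaces are the three kinds of terms of [group_d]. The Hochschild
    complex thus already computes differentiable cohomology, and only the Connes operator has to be
    removed. *)
Lemma group_dE p (phi : cochain G M p) : group_d act phi = hochschild_b act phi.
Proof.
apply/funext => g; rewrite /hochschild_b fct_sumE big_ord_recl big_ord_recr /=.
rewrite /group_d addrA; congr (_ + _ + _).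
- by rewrite /coface unlift_none /= -[RHS]/(1 *: coface_first act phi g) scale1r.
- apply: eq_bigr => i _.
  rewrite /coface liftK.
  have -> : widen_ord (leqnSn p) i = lift ord_max i.
    by apply: val_inj; rewrite /= /bump leqNgt ltn_ord.
  rewrite liftK -[RHS]/((-1) ^+ i.+1 *: coface_mid i phi g); congr (_ *: phi _).
  by apply/funext => j; case: (j =P i) => [->|].
- by rewrite /coface liftK unlift_none.
Qed.

Definition tot_d x : bicochain G M := fun p => (-1) ^+ p *: cochain_d (x p).
Arguments tot_d x p : clear implicits, rename.

Lemma total_hochschildE x : total_d (@hochschild_b R n m G M act) x = tot_b act x + tot_d x.
Proof.
apply/functional_extensionality_dep => -[|p] //.
rewrite -[RHS]/(0 + 1 *: cochain_d (x 0%N)).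
by rewrite add0r scale1r.
Qed.

Lemma total_groupE x : total_d (@group_d R n m G M act) x = tot_b act x + tot_d x.
Proof.
rewrite -total_hochschildE; apply/functional_extensionality_dep => -[|p] //=.
by rewrite group_dE.
Qed.

Lemma tot_TE j x p : tot_T j x p =
  \sum_(t <- T_words G M j p) t.1 *: ((fun g => x (p + j.*2)%N (word_subst t.2 g)) : cochain G M p).
Proof. by apply/funext => g; rewrite fct_sumE. Qed.

Lemma smooth_cochain_sum p (I : Type) (r : seq I) (a : I -> R) (phi : I -> cochain G M p) :
  (forall i, smooth_cochain (phi i)) ->
  smooth_cochain (\sum_(i <- r) a i *: phi i : cochain G M p).
Proof.
move=> phiS; elim: r => [|i r IH]; first by rewrite big_nil; exact: smooth_cochain_zero.
by rewrite big_cons; apply: smooth_cochain_linear.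
Qed.

Lemma cochain_d_sum p (I : Type) (r : seq I) (a : I -> R) (phi : I -> cochain G M p) :
  (forall i, smooth_cochain (phi i)) ->
  cochain_d (\sum_(i <- r) a i *: phi i : cochain G M p) =
  \sum_(i <- r) a i *: cochain_d (phi i).
Proof.
move=> phiS; elim: r => [|i r IH]; last first.
  by rewrite !big_cons cochain_d_linear // ?IH //; exact: smooth_cochain_sum.
rewrite !big_nil.
have s0 := smooth_cochain_zero G M p.
have := @cochain_d_linear R n m G M p (-1) 0 0 s0 s0.
by rewrite scaler0 addr0 scaleN1r addNr.
Qed.

Lemma smooth_word_substP j x p u : (forall p, smooth_cochain (x p)) ->
  smooth_cochain ((fun g => x (p + j.*2)%N (word_subst u g)) : cochain G M p).
Proof. by move=> xS; apply: smooth_cochain_reindex => // i; exact: smooth_word_subst. Qed.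

(** The group degree drops by [2j] while the form degree [q] is unchanged. *)
Lemma total_cochain_T j d x : total_cochain d x -> total_cochain (d - (2 * j)%N%:Z) (tot_T j x).
Proof.
move=> [xS xd]; split=> [p|p g q pqd].
  by rewrite tot_TE; apply: smooth_cochain_sum => t; exact: smooth_word_substP.
rewrite /tot_T [LHS](_ : _ =
  \sum_(t <- T_words G M j p) t.1 *: x (p + j.*2)%N (word_subst t.2 g) q).
  rewrite big1 // => t _; rewrite xd ?scaler0 // => e; apply: pqd.
  by rewrite -e -mul2n addnAC (PoszD (p + q)) addrK.
by elim/big_rec2: _ => // t u v _ <-.
Qed.

(** The de Rham differential acts at each group argument separately and so commutes with
    substitution; the sign [(-1) ^+ p] survives the even shift of [p]. Smoothness makes [cochain_d]
    additive on the sum of words. *)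
Lemma tot_d_T j x : (forall p, smooth_cochain (x p)) -> tot_d (tot_T j x) = tot_T j (tot_d x).
Proof.
move=> xS; apply/functional_extensionality_dep => p.
rewrite /tot_d !tot_TE cochain_d_sum; last by move=> t; exact: smooth_word_substP.
rewrite scaler_sumr; apply: eq_bigr => t _.
set phi := cochain_d _.
rewrite -[RHS]/(t.1 *: ((-1) ^+ (p + j.*2) *: phi)) !scalerA mulrC; congr (_ * _ *: _).
by rewrite exprD -mul2n exprM sqrrN !expr1n mulr1.
Qed.

Lemma total_cochain_sum d (I : Type) (r : seq I) (x : I -> bicochain G M) :
  (forall i, total_cochain d (x i)) -> total_cochain d (\sum_(i <- r) x i).
Proof.
move=> xc; elim: r => [|i r IH]; first by rewrite big_nil; exact: total_cochain_zero.
by rewrite big_cons -[x i]scale1r; apply: total_cochain_linear.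
Qed.

Lemma total_d_sum d (I : Type) (r : seq I) (x : I -> bicochain G M) :
  (forall i, total_cochain d (x i)) ->
  total_d (@group_d R n m G M act) (\sum_(i <- r) x i) =
  \sum_(i <- r) total_d (@group_d R n m G M act) (x i).
Proof.
have dL := total_d_linear (@group_d_linear R n m G M act).
move=> xc; elim: r => [|i r IH].
  rewrite !big_nil.
  have := dL d (-1) 0 0 (total_cochain_zero _ _ _) (total_cochain_zero _ _ _).
  by rewrite scaler0 addr0 scaleN1r addNr.
rewrite !big_cons -IH -[X in _ = X + _]scale1r -(dL d) ?scale1r //.
exact: total_cochain_sum.
Qed.

Lemma total_d_T j d x : total_cochain d x ->
  total_d (@group_d R n m G M act) (tot_T j x) =
  tot_T j (total_d (@hochschild_b R n m G M act) x) +
  (if j is j'.+1 then tot_T j' (tot_B act x) else 0).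
Proof.
move=> [xS _]; rewrite total_groupE total_hochschildE tot_d_T //.
have TD u v : tot_T j (u + v) = tot_T j u + tot_T j v :> bicochain G M.
  by rewrite -[u]scale1r (tot_T_linear hact) !scale1r.
rewrite TD; case: j {TD} => [|j]; first by rewrite !(tot_T0 hact) addr0.
by rewrite (tot_b_T hact) addrAC.
Qed.

Definition hat_T y : nat -> bicochain G M := fun k => \sum_(j < k.+1) tot_T j (y (k - j)%N).

Lemma hat_T_linear a y z k : hat_T (a *: y + z) k = a *: hat_T y k + hat_T z k.
Proof.
rewrite /hat_T scaler_sumr -big_split; apply: eq_bigr => j _.
exact: (tot_T_linear hact).
Qed.

Lemma hat_T_cochain d y : cyclic_cochain d y -> cyclic_cochain d (hat_T y).
Proof.
move=> yc k; apply: total_cochain_sum => j.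
have := total_cochain_T j (yc (k - j)%N); congr total_cochain.
rewrite -addrA -opprD -PoszD -mulnDr subnK //.
by rewrite -ltnS.
Qed.

(** The Connes terms of [cyclic_d] on the left are the corrections from moving the differential past
    [tot_T j.+1] on the right, with the summation index shifted by one. *)
Lemma hat_T_diff d y k : cyclic_cochain d y ->
  hat_T (cyclic_d act y) k = total_d (@group_d R n m G M act) (hat_T y k).
Proof.
move=> yc; have yk (j : 'I_k.+1) := yc (k - j)%N.
have Tc (j : 'I_k.+1) : total_cochain (d - (2 * k)%N%:Z) (tot_T j (y (k - j)%N)).
  have := total_cochain_T j (yk j); congr total_cochain.
  by rewrite -addrA -opprD -PoszD -mulnDr subnK // -ltnS.
rewrite (total_d_sum _ Tc).
under [RHS]eq_bigr => j _ do rewrite (total_d_T _ (yk j)).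
rewrite big_split /=.
have TD (j : nat) u v : tot_T j (u + v) = tot_T j u + tot_T j v :> bicochain G M.
  by rewrite -[u]scale1r (tot_T_linear hact) !scale1r.
have T0 (j : nat) : tot_T j 0 = 0 :> bicochain G M.
  by have := tot_T_linear hact j (-1) 0 0; rewrite scaler0 addr0 scaleN1r addNr.
pose By k' : bicochain G M := if k' is l.+1 then tot_B act (y l) else 0.
rewrite [LHS](eq_bigr (fun j : 'I_k.+1 =>
    (tot_T j (total_d (@hochschild_b R n m G M act) (y (k - j)%N)) : bicochain G M) +
    tot_T j (By (k - j)%N))); last by move=> j _; exact: TD.
rewrite big_split /=; congr (_ + _).
(* The unmatched end terms vanish: [By 0] is zero on the left, and [tot_T 0] has no correction on
   the right. *)
rewrite big_ord_recr [RHS]big_ord_recl /= subnn T0 addr0 add0r.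
by apply: eq_bigr => j _; rewrite -(subnSK (ltn_ord j)).
Qed.

(** The strictly triangular part of [hat_T]: component [k] uses only components of [y] below [k]. *)
Definition hat_K y : nat -> bicochain G M :=
  fun k => \sum_(j < k) tot_T j.+1 (y (k - j.+1)%N).

Lemma hat_TE y k : hat_T y k = y k + hat_K y k.
Proof. by rewrite /hat_T big_ord_recl (tot_T0 hact) subn0. Qed.

Lemma eq_hat_K y z k : (forall l, (l < k)%N -> y l = z l) -> hat_K y k = hat_K z k.
Proof.
move=> yz; apply: eq_bigr => j _; rewrite yz // ltn_subrL /=.
exact: leq_ltn_trans (ltn_ord j).
Qed.

Lemma hat_T_inj y z : (forall k, hat_T y k = hat_T z k) -> y = z.
Proof.
move=> e; apply/funext => k; have [N] := ubnP k; elim: N k => // N IH k kN.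
have := e k; rewrite !hat_TE (@eq_hat_K y z) => [/addIr //|l lk].
by apply: IH; apply: leq_trans lk _.
Qed.

Lemma hat_K_cochain d y : cyclic_cochain d y -> cyclic_cochain d (hat_K y).
Proof.
move=> yc k; have -> : hat_K y k = -1 *: y k + hat_T y k.
  by rewrite hat_TE scaleN1r addKr.
by apply: total_cochain_linear; [exact: yc|exact: hat_T_cochain].
Qed.

(** The equation [y = z - hat_K y] is solved by iteration from 0; component [k] is stable from step
    [k.+1] on. *)
Lemma hat_T_onto d z : cyclic_cochain d z ->
  exists2 y, cyclic_cochain d y & forall k, hat_T y k = z k.
Proof.
move=> zc; pose step y : nat -> bicochain G M := fun k => z k - hat_K y k.
pose s i := iter i step 0.
have sc i : cyclic_cochain d (s i).
  elim: i => [|i IH] k; first exact: total_cochain_zero.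
  have -> : s i.+1 k = -1 *: hat_K (s i) k + z k by rewrite scaleN1r [RHS]addrC.
  by apply: total_cochain_linear; [exact: hat_K_cochain|exact: zc].
have st k i j : (k < i)%N -> (k < j)%N -> s i k = s j k.
  have [N] := ubnP k; elim: N k i j => // N IH k [//|i] [//|j] kN ki kj.
  rewrite -[LHS]/(z k - hat_K (s i) k) -[RHS]/(z k - hat_K (s j) k).
  congr (_ - _); apply: eq_hat_K => l lk.
  by apply: IH; apply: leq_trans lk _.
(* The diagonal takes each component at the first step where it is stable. *)
exists (fun k => s k.+1 k) => [k|k]; first exact: sc.
rewrite hat_TE -[s k.+1 k]/(z k - hat_K (s k) k) (@eq_hat_K _ (s k)) ?subrK // => l lk.
exact: st.
Qed.

Lemma total_cochain_neg d x : d < 0 -> total_cochain d x -> x = 0.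
Proof.
move=> d0 [_ xd]; apply/functional_extensionality_dep => p; apply/funext => g.
apply/functional_extensionality_dep => q; apply: xd => e.
by rewrite -e in d0.
Qed.

End Comparison.

Theorem theorem2p1 (R : realType) (n m : nat) (G : lieGroupType R n)
    (M : manifoldType R m) (act : G -> M -> M) (hact : smooth_action act)
    (d : int) :
  exists f : {linear cyclic_cohomology act d ->
      direct_sum (fun k : nat =>
        differentiable_cohomology act (d - (2 * k)%N%:Z))},
    bijective f.
Proof.
apply: (@cohomology_direct_sum R nat (cyclic_complex act) (fun=> group_complex act)
  (@hat_T R n m G M) (fun k => (2 * k)%N%:Z) d).
- by move=> y z; exact: (hat_T_inj hact).
- by move=> a y z k; exact: (hat_T_linear hact).
- by move=> e y yc k; exact: hat_T_cochain.
- by move=> e z zc; exact: (hat_T_onto hact).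
- by move=> e y yc k; exact: (hat_T_diff hact k yc).
(* For [k] above the absolute value of [d] the degree [d - 2k] is negative and every total cochain
   vanishes. *)
apply: (@sub_finite_set _ _ `I_`|d|.+1); last exact: finite_II.
move=> k /= [z zc z0]; rewrite ltnNge; apply/negP => dk; apply: z0.
apply: total_cochain_neg zc.
rewrite subr_lt0 (Order.POrderTheory.le_lt_trans (ler_norm d)) // -abszE ltz_nat.
by rewrite (leq_trans dk) // leq_pmull.
Qed.
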